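(* There exists a numerical constant $c>0$ such that the following holds. Let $d\ge1$ and $N\ge2$ be integers, let $\mathcal A_1\subset\mathcal B(H_1)$ be a unital $C^*$-algebra equipped with a faithful normal state $\tau_1$, and let $a_0,a_1,\ldots,a_{2d}\in\mathcal A_1$ have non-negative joint moments. Let $U_1,\ldots,U_d$ be arbitrary $N\times N$ permutation matrices and set $U_{i+d}=U_i^*$ for $1\le i\le d$. Let $$A_{\mathrm F}=a_0\otimes 1+\sum_{i=1}^{2d}a_i\otimes\lambda(g_i)\in\mathcal A_1\otimes\mathcal A_{\mathrm F},\qquad A_N=a_0\otimes 1+\sum_{i=1}^{2d}a_i\otimes U_i\in\mathcal A_1\otimes M_N(\mathbb C).$$ Then $$\|A_N\Pi_N\|\ge\|A_{\mathrm F}\|\left(1-c\,\frac{\log(2d)}{\sqrt{\log N}}\right).$$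
   Context: Tensor products of $C^*$-algebras are minimal. $\mathrm F_d$ is the free group with free generators $g_1,\ldots,g_d$; for $d+1\le i\le 2d$, $g_i=g_{i-d}^{-1}$. $\lambda$ is the left regular representation on $\ell^2(\mathrm F_d)$, $\lambda(g)\delta_h=\delta_{gh}$, and $\mathcal A_{\mathrm F}$ is the reduced $C^*$-algebra generated by the $\lambda(g)$. $(a_0,\ldots,a_{2d})$ have non-negative joint moments if $\tau_1(a_{i_1}^{\varepsilon_1}\cdots a_{i_n}^{\varepsilon_n})\ge0$ for all $n$, all $(i_1,\ldots,i_n)\in\{0,\ldots,2d\}^n$ and all choices $a_{i_k}^{\varepsilon_k}\in\{a_{i_k},a_{i_k}^*\}$. $\Pi_N=1_{H_1}\otimes(1_{\mathbb C^N}-\mathbf 1_N\otimes\mathbf 1_N)$, where $\mathbf 1_N\in\mathbb C^N$ is the unit vector with all coordinates $1/\sqrt N$ and $\mathbf 1_N\otimes\mathbf 1_N$ denotes the orthogonal projection onto $\mathbb C\mathbf 1_N$. $\|\cdot\|$ is the operator norm. A numerical constant is one independent of all parameters. *)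

(* Defs.v *)
From HB Require Import structures.
From mathcomp Require Import all_boot all_order all_algebra.
From mathcomp Require Import monoid sesquilinear spectral complex.
From mathcomp Require Import all_classical all_reals all_analysis.
Import numFieldNormedType.Exports.

Set Implicit Arguments.
Unset Strict Implicit.
Unset Printing Implicit Defensive.

Import Order.TTheory GRing.Theory Num.Theory Num.Def.

Local Open Scope ring_scope.
Local Open Scope classical_set_scope.
Local Open Scope complex_scope.

(* The inner product is linear in its first argument and conjugate linear in
   its second one. *)
HB.mixin Record isHilbert (R : realType) H of CompleteNormedModule R[i] H := {
  inner : {dot H for conjC};
  inner_normE : forall x : H, inner x x = `|x| ^+ 2 }.

#[short(type="hilbertType")]
HB.structure Definition Hilbert (R : realType) :=
  {H of CompleteNormedModule R[i] H & isHilbert R H}.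

Section OperatorAlgebra.
Variables (R : realType) (H : hilbertType R).
Implicit Types (a b : H -> H) (A : set (H -> H)) (tau : (H -> H) -> R[i]).

Definition bounded_operator a : Prop :=
  linear a /\ exists M : R[i], forall x, `|a x| <= M * `|x|.

Definition is_adjoint a b : Prop :=
  forall x y, inner (a x) y = inner x (b y).

(* 0 is a dummy value for maps that have no adjoint. *)
Definition adj a : H -> H := xget 0 [set b | is_adjoint a b].

Lemma adjE a b : is_adjoint a b -> adj a = b.
Proof.
rewrite /adj => ab; case: xgetP => [c _ /= ac|/(_ b)//].
apply/funext => y; apply/eqP; rewrite -subr_eq0 -normr_eq0 -sqrf_eq0.
suff o x : inner x (c y - b y) = 0 by rewrite -inner_normE o.
have -> : inner x (c y - b y) = inner x (c y) - inner x (b y) by exact: linearB.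
by rewrite -[inner x (c y)](ac x y) -[inner x (b y)](ab x y) subrr.
Qed.

(* Concrete unital C*-subalgebras of B(H), with the unit of B(H). *)
Record unital_cstar_algebra A : Prop := {
  cstar_bounded : forall a, A a -> bounded_operator a;
  cstar_unit : A id;
  cstar_add : forall a b, A a -> A b -> A (a + b);
  cstar_scale : forall (k : R[i]) a, A a -> A (k *: a);
  cstar_mul : forall a b, A a -> A b -> A (a \o b);
  cstar_adj : forall a, A a -> exists2 b, A b & is_adjoint a b;
  cstar_closed : forall b, bounded_operator b ->
    (forall e : R, 0 < e ->
       exists2 a, A a & forall x, `|b x - a x| <= e%:C * `|x|) ->
    A b }.

(* The order of R[i] makes [0 <= z] mean that z is real and nonnegative. *)
Record state_on A tau : Prop := {
  state_linear : forall (k : R[i]) a b, A a -> A b ->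
    tau (k *: a + b) = k * tau a + tau b;
  state_pos : forall a, A a -> 0 <= tau (adj a \o a);
  state_unit : tau id = 1 }.

Definition faithful_on A tau : Prop :=
  forall a, A a -> tau (adj a \o a) = 0 -> a = 0.

Definition selfadjoint a : Prop := bounded_operator a /\ is_adjoint a a.

Definition op_le a b : Prop := forall x, 0 <= inner (b x - a x) x.

Definition op_lub (D : set (H -> H)) s : Prop :=
  [/\ selfadjoint s, forall a, D a -> op_le a s &
      forall b, selfadjoint b -> (forall a, D a -> op_le a b) -> op_le s b].

Definition op_directed (D : set (H -> H)) : Prop :=
  D !=set0 /\ forall a b, D a -> D b -> exists c, [/\ D c, op_le a c & op_le b c].

(* A state on A is normal if it preserves the suprema, taken in B(H), of
   bounded increasing nets of self-adjoint elements of A, when these suprema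
   belong to A; such nets are represented by upward directed sets. *)
Definition normal_on A tau : Prop :=
  forall (D : set (H -> H)) s,
    D `<=` A -> D `<=` selfadjoint -> op_directed D ->
    A s -> op_lub D s -> supremums (tau @` D) (tau s).

Definition nonneg_joint_moments (I : Type) tau (a : I -> H -> H) : Prop :=
  forall (n : nat) (i : 'I_n -> I) (star : 'I_n -> bool),
    0 <= tau (\big[(fun b c => b \o c)/id]_(k < n)
                 (if star k then adj (a (i k)) else a (i k))).

End OperatorAlgebra.

Section HilbertTensor.
Variables (R : realType) (H : hilbertType R).

(* H (x) l^2(I) is realized as the space l^2(I; H) of the maps f : I -> H such
   that [l2sqnorm f] is finite, the elementary tensor of x : H and
   xi : I -> R[i] being [tens_vec x xi]. *)
Definition tens_vec (I : Type) (x : H) (xi : I -> R[i]) : I -> H :=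
  fun i => xi i *: x.

Definition l2sqnorm (I : choiceType) (f : I -> H) : \bar R :=
  \esum_(i in [set: I]) ((complex.Re `|f i|) ^+ 2)%:E.

(* Operator norm on l^2(I; H). *)
Definition opnorm (I : choiceType) (T : (I -> H) -> (I -> H)) : \bar R :=
  ereal_sup [set sqrte (l2sqnorm (T f)) | f in [set f | (l2sqnorm f <= 1)%E]].

(* a (x) 1 *)
Definition ampl (I : Type) (a : H -> H) : (I -> H) -> (I -> H) :=
  fun f i => a (f i).

(* a (x) M on H (x) C^N *)
Definition tens_mx (N : nat) (a : H -> H) (M : 'M[R[i]]_N) :
    ('I_N -> H) -> ('I_N -> H) :=
  fun f i => \sum_(j < N) M i j *: a (f j).

Lemma tens_mx_tens_vec N (a : H -> H) (M : 'M[R[i]]_N) (x : H) (v : 'cV[R[i]]_N) :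
  linear a ->
  tens_mx a M (tens_vec x (v ^~ 0)) = tens_vec (a x) ((M *m v) ^~ 0).
Proof.
move=> la; have aZ k y : a (k *: y) = k *: a y.
  have a0 : a 0 = 0.
    by have := la (-1) 0 0; rewrite scaler0 addr0 scaleN1r addNr.
  by have := la k y 0; rewrite !addr0 a0 addr0.
apply/funext => i; rewrite /tens_mx /tens_vec mxE scaler_suml.
by apply: eq_bigr => j _; rewrite aZ scalerA.
Qed.

(* The projection of C^N onto the line of the constant vectors. *)
Definition unit_ones N : 'cV[R[i]]_N := const_mx ((Num.sqrt N%:R)^-1)%:C.

Definition proj_ones N : 'M[R[i]]_N :=
  (unit_ones N *m ((unit_ones N) ^t*)%sesqui)%R.

Definition PiN N : ('I_N -> H) -> ('I_N -> H) :=
  tens_mx id (1%:M - proj_ones N).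

End HilbertTensor.
Arguments PiN {R} H N.

(* The free group on d generators, as reduced words: the letter (i, false) is
   the i-th generator and (i, true) is its inverse. *)
Section FreeGroup.
Variable d : nat.
Local Notation letter := ('I_d * bool)%type.
Implicit Types (x y : letter) (u v w : seq letter).

Definition linv x : letter := (x.1, ~~ x.2).

Definition reduced w : bool := sorted (fun x y => y != linv x) w.

(* x w, reduced, for w reduced *)
Definition lcons x w : seq letter :=
  if w is y :: w' then (if y == linv x then w' else x :: w) else [:: x].

Definition wmul u v : seq letter := foldr lcons v u.
Definition winv w : seq letter := rev (map linv w).

Lemma linvK : involutive linv.
Proof. by case=> i b; rewrite /linv /= negbK. Qed.

Lemma reduced_lcons x w : reduced w -> reduced (lcons x w).
Proof.
case: w => [|y w] //= rw; case: eqP => [_|/eqP yx].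
  exact: path_sorted rw.
by rewrite /= yx.
Qed.

Lemma lconsK x w : reduced w -> lcons (linv x) (lcons x w) = w.
Proof.
case: w => [|y w] /=; first by rewrite linvK eqxx.
case: eqP => [->|_ _] /=; last by rewrite linvK eqxx.
by case: w => [|z w] //= /andP[/negbTE->].
Qed.

Lemma reduced_wmul u v : reduced v -> reduced (wmul u v).
Proof. by move=> rv; elim: u => //= x u; exact: reduced_lcons. Qed.

Lemma wmul_lcons x u v : reduced v -> wmul (lcons x u) v = lcons x (wmul u v).
Proof.
move=> rv; case: u => [|y u] //=; case: eqP => [->|//].
have := lconsK (linv x) (reduced_wmul u rv).
by rewrite linvK.
Qed.

Lemma wmulA u v w : reduced w -> wmul u (wmul v w) = wmul (wmul u v) w.
Proof. by move=> rw; elim: u => //= x u ->; rewrite wmul_lcons. Qed.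

Lemma wmulw0 u : reduced u -> wmul u [::] = u.
Proof.
elim: u => //= x u IH pu; rewrite IH; last exact: path_sorted pu.
by case: u pu {IH} => //= y u /andP[/negbTE-> _].
Qed.

Lemma winvK : involutive winv.
Proof. by move=> w; rewrite /winv map_rev revK mapK //; exact: linvK. Qed.

Lemma reduced_winv w : reduced w -> reduced (winv w).
Proof.
rewrite /reduced /winv rev_sorted sorted_map; apply: sub_sorted => x y /=.
by apply: contra => /eqP /(can_inj linvK) ->; rewrite linvK.
Qed.

Lemma wmulVw w : reduced w -> wmul (winv w) w = [::].
Proof.
elim: w => //= x w IH pw; rewrite /winv /= rev_cons /wmul foldr_rcons /=.
rewrite linvK eqxx; apply: IH; exact: path_sorted pw.
Qed.

Record free_group := FreeGroup { word :> seq letter; _ : reduced word }.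

HB.instance Definition _ := [isSub for word].
HB.instance Definition _ := [Choice of free_group by <:].

Lemma word_reduced (g : free_group) : reduced g. Proof. exact: valP. Qed.

Definition fg_one : free_group := @FreeGroup [::] isT.
Definition fg_mul (g h : free_group) : free_group :=
  FreeGroup (reduced_wmul g (word_reduced h)).
Definition fg_inv (g : free_group) : free_group :=
  FreeGroup (reduced_winv (word_reduced g)).

Lemma fg_mulA : associative fg_mul.
Proof. by move=> g h k; apply/val_inj/wmulA/word_reduced. Qed.
Lemma fg_mul1g : left_id fg_one fg_mul.
Proof. by move=> g; apply/val_inj. Qed.
Lemma fg_mulg1 : right_id fg_one fg_mul.
Proof. by move=> g; apply/val_inj/wmulw0/word_reduced. Qed.
Lemma fg_mulVg : left_inverse fg_one fg_inv fg_mul.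
Proof. by move=> g; apply/val_inj/wmulVw/word_reduced. Qed.
Lemma fg_mulgV : right_inverse fg_one fg_inv fg_mul.
Proof.
move=> g; apply/val_inj; rewrite /= -{1}[word g]winvK.
exact/wmulVw/reduced_winv/word_reduced.
Qed.

HB.instance Definition _ :=
  isGroup.Build free_group fg_mulA fg_mul1g fg_mulg1 fg_mulVg fg_mulgV.

Definition fg_gen (i : 'I_d) : free_group := @FreeGroup [:: (i, false)] isT.

End FreeGroup.

(* The family x_1, ..., x_d, y_1, ..., y_d. *)
Definition fam_double (T : Type) (d : nat) (x y : 'I_d -> T) (i : 'I_(d + d)) : T :=
  match fintype.split i with inl j => x j | inr j => y j end.

Definition fg_letter (d : nat) : 'I_(d + d) -> free_group d :=
  fam_double (@fg_gen d) (fun j => (fg_gen j)^-1)%g.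

(* Left translation of E-valued functions; for E = R[i] this is the left
   regular representation, and for E = H it is 1 (x) lreg g. *)
Definition lreg (d : nat) (E : Type) (g : free_group d) (f : free_group d -> E) :
    free_group d -> E :=
  fun h => f (g^-1 * h)%g.

Lemma lreg_delta (R : realType) d (g h : free_group d) :
  lreg g (fun k => (k == h)%:R : R[i]) = (fun k => (k == (g * h)%g)%:R).
Proof.
apply/funext => k; rewrite /lreg; congr (_%:R); congr nat_of_bool.
by apply/eqP/eqP => [<-|->]; rewrite ?mulVKg ?mulKg.
Qed.

(* a (x) lreg g on H (x) l^2(F_d) *)
Definition tens_lreg (R : realType) (H : hilbertType R) (d : nat) (a : H -> H)
    (g : free_group d) : (free_group d -> H) -> (free_group d -> H) :=
  ampl a \o lreg g.

Lemma tens_lreg_tens_vec (R : realType) (H : hilbertType R) d (a : H -> H)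
    (g : free_group d) (x : H) (xi : free_group d -> R[i]) :
  scalable a ->
  tens_lreg a g (tens_vec x xi) = tens_vec (a x) (lreg g xi).
Proof. by move=> aZ; apply/funext => h; exact: aZ. Qed.

Section Operators.
Variables (R : realType) (H : hilbertType R) (d : nat).
(* a ord0 is a_0, and a (lift ord0 i) is the coefficient of the i-th letter. *)
Variable a : 'I_(d + d).+1 -> H -> H.

Definition A_free : (free_group d -> H) -> (free_group d -> H) :=
  ampl (a ord0) + \sum_(i < d + d) tens_lreg (a (lift ord0 i)) (fg_letter i).

Definition A_mx (N : nat) (U : 'I_d -> 'M[R[i]]_N) : ('I_N -> H) -> ('I_N -> H) :=
  ampl (a ord0) + \sum_(i < d + d)
    tens_mx (a (lift ord0 i)) (fam_double U (fun j => (U j ^t*)%sesqui) i).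

End Operators.

(* Main.v *)
(* Let p be about log N / log (2d) and m about sqrt (log N) / log (2d).

   Let T be the coefficient at the unit of |A_F|^(2p). A word that is trivial in
   the free group fixes every point of [N], so with non-negative joint moments
   tau (T^k T T^k) <= tau (T^k W T^k), where W is a diagonal coefficient of
   |A_N|^(2p). Removing the constants from delta_x costs the term of order 1/N in
     tau (T^(2k+1)) <= (||A_N Pi||^(2p) + ((2d+1) ||A_F||)^(2p) / N) tau (T^(2k)),
   and since tau is faithful these ratios determine ||T||.

   A vector f supported in a ball of radius 2m is a sum of at most (2d+1)^(2m)
   vectors y (x) delta_h, hence log-convexity of the moments of |A_F|^2 at f gives
     ||A_F f||^(2p) <= (2d+1)^(2m) ||T|| ||f||^(2p).

   The general case reduces to such f by cutoffs: weights given by a tent of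
   width of order m along the geodesics of the Cayley tree towards the root. The
   parts of A_F that raise and lower the length of words have norm at most
   ||A_F||, whence the commutators of A_F with the cutoffs cost a factor
   1 - O(1/m). *)
Require Import Defs.
From mathcomp Require Import all_boot all_order all_algebra.
From mathcomp Require Import fingroup perm.
From mathcomp Require Import monoid sesquilinear spectral complex.
From mathcomp Require Import all_classical all_reals all_analysis.
From mathcomp Require Import ring lra zify.
Import numFieldNormedType.Exports.

Set Implicit Arguments.
Unset Strict Implicit.
Unset Printing Implicit Defensive.

Import Order.TTheory GRing.Theory Num.Theory.
Local Open Scope ring_scope.
Local Open Scope classical_set_scope.
Local Open Scope complex_scope.

(** The difference W - T is a sum of words but in general not a positive operator, and [tau] is not
    assumed to be a trace, so T and W are compared only through moments. Since T^k is itself a sum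
    of words, tau (T^k (W - T) T^k) is a sum of joint moments and hence nonnegative. The bound on W
    by ||A_N Pi||^(2p) and the 1/N term is an operator inequality and survives conjugation by T^k.

    The choice of p and m balances two losses. The p-th root of the size of a ball costs
    (2d+1)^(2m/p). The cutoffs cost 1/m: the squares of the tent sum to order m^3, those of its
    increments to order m, and the best splitting of the commutator turns the ratio m^(-2) into 1/m.
    Both losses are then of order log (2d) / sqrt (log N), while (2d+1)^(2p) stays below a small
    power of N, so that the 1/N term is negligible. *)

(** * Real inner product *)

Section RealInnerProduct.
Variables (R : realType) (H : hilbertType R).
Implicit Types (x y z : H) (r s : R).

Definition rip x y : R := complex.Re (inner x y).
Definition sqn x : R := rip x x.
Definition rn x : R := complex.Re `|x|.

Lemma rip_sym x y : rip x y = rip y x.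
Proof.
rewrite /rip (hermC _ x y) expr0 mul1r.
by rewrite [LHS](_ : _ = complex.Re (inner y x)^*) //; case: (inner y x).
Qed.

Lemma ripDl x y z : rip (x + y) z = rip x z + rip y z.
Proof. by rewrite /rip linearDl /= raddfD. Qed.

Lemma ripDr x y z : rip x (y + z) = rip x y + rip x z.
Proof. by rewrite rip_sym ripDl !(rip_sym x). Qed.

Lemma ripZl r x y : rip (r%:C *: x) y = r * rip x y.
Proof.
by rewrite /rip linearZl_LR /=; case: (inner x y) => a b /=; rewrite mul0r subr0.
Qed.

Lemma ripZr r x y : rip x (r%:C *: y) = r * rip x y.
Proof. by rewrite rip_sym ripZl rip_sym. Qed.

Lemma ripNl x y : rip (- x) y = - rip x y.
Proof. by rewrite /rip linearNl /= raddfN. Qed.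

Lemma ripNr x y : rip x (- y) = - rip x y.
Proof. by rewrite rip_sym ripNl rip_sym. Qed.

Lemma rip0l y : rip 0 y = 0.
Proof. by rewrite /rip linear0l. Qed.

Lemma rip0r y : rip y 0 = 0.
Proof. by rewrite rip_sym rip0l. Qed.

Lemma rip_suml (I : Type) (s : seq I) (P : pred I) (F : I -> H) y :
  rip (\sum_(i <- s | P i) F i) y = \sum_(i <- s | P i) rip (F i) y.
Proof.
by elim/big_rec2: _ => [|i u v _ <-]; rewrite ?rip0l // ripDl.
Qed.

Lemma rip_sumr (I : Type) (s : seq I) (P : pred I) (F : I -> H) y :
  rip y (\sum_(i <- s | P i) F i) = \sum_(i <- s | P i) rip y (F i).
Proof. by rewrite rip_sym rip_suml; apply: eq_bigr => i _; rewrite rip_sym. Qed.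

Lemma normE x : `|x| = (rn x)%:C.
Proof. by rewrite /rn RRe_real // normr_real. Qed.

Lemma rn_ge0 x : 0 <= rn x.
Proof. by rewrite -ler0c -normE. Qed.

Lemma sqnE x : sqn x = rn x ^+ 2.
Proof. by rewrite /sqn /rip inner_normE normE -rmorphXn. Qed.

Lemma sqn_ge0 x : 0 <= sqn x.
Proof. by rewrite sqnE sqr_ge0. Qed.

Lemma rnD x y : rn (x + y) <= rn x + rn y.
Proof. by rewrite -lecR rmorphD /= -!normE ler_normD. Qed.

Lemma rn_sum (I : Type) (s : seq I) (P : pred I) (F : I -> H) :
  rn (\sum_(i <- s | P i) F i) <= \sum_(i <- s | P i) rn (F i).
Proof.
elim/big_rec2: _ => [|i u v _ uv]; first by rewrite /rn normr0.
by apply: (le_trans (rnD _ _)); rewrite lerD2l.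
Qed.

Lemma rnZc (k : R[i]) x : rn (k *: x) = complex.Re `|k| * rn x.
Proof. by apply: complexI; rewrite -normE normrZ rmorphM /= -normE. Qed.

Lemma rnZ r x : rn (r%:C *: x) = `|r| * rn x.
Proof. by rewrite rnZc normc_def /= expr0n addr0 sqrtr_sqr. Qed.

Lemma rnN x : rn (- x) = rn x.
Proof. by rewrite /rn normrN. Qed.

Lemma rnB x y : rn (x - y) <= rn x + rn y.
Proof. by rewrite -(rnN y) rnD. Qed.

Lemma rn0 : rn 0 = 0. Proof. by rewrite /rn normr0. Qed.

Lemma rn_eq0 x : rn x = 0 -> x = 0.
Proof. by move=> x0; apply/eqP; rewrite -normr_eq0 normE x0. Qed.

Lemma sqn_eq0 x : sqn x = 0 -> x = 0.
Proof. by rewrite sqnE => /eqP; rewrite sqrf_eq0 => /eqP; exact: rn_eq0. Qed.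

Lemma sqnD x y : sqn (x + y) = sqn x + 2 * rip x y + sqn y.
Proof. rewrite /sqn ripDl !ripDr (rip_sym y x); ring. Qed.

Lemma sqnN x : sqn (- x) = sqn x.
Proof. by rewrite !sqnE rnN. Qed.

Lemma sqnZ r x : sqn (r%:C *: x) = r ^+ 2 * sqn x.
Proof. by rewrite /sqn ripZl ripZr mulrA expr2. Qed.

Lemma rip_le x y : rip x y <= rn x * rn y.
Proof.
have [y0|y0] := eqVneq (rn y) 0.
  by rewrite (rn_eq0 y0) rip0r rn0 mulr0.
have [x0|x0] := eqVneq (rn x) 0.
  by rewrite (rn_eq0 x0) rip0l rn0 mul0r.
have px : 0 < rn x by rewrite lt0r x0 rn_ge0.
have py : 0 < rn y by rewrite lt0r y0 rn_ge0.
(* For this combination the expanded square is 2 |x| |y| (|x| |y| - <x,y>). *)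
have := sqn_ge0 ((rn y)%:C *: x - (rn x)%:C *: y).
rewrite sqnD sqnN !sqnZ ripNr ripZl ripZr !sqnE => h.
have: 0 <= (2 * rn x * rn y) * (rn x * rn y - rip x y) by lra.
by rewrite pmulr_rge0 ?subr_ge0 // !mulr_gt0.
Qed.

Lemma normr_rip_le x y : `|rip x y| <= rn x * rn y.
Proof.
rewrite ler_norml rip_le andbT; have := rip_le (- x) y.
by rewrite ripNl rnN; lra.
Qed.

Lemma rip_ext x y : (forall z, rip x z = rip y z) -> x = y.
Proof.
by move=> xy; apply/subr0_eq/sqn_eq0; rewrite /sqn ripDl ripNl xy subrr.
Qed.

(* The real inner product determines the complex one, as [Im<x,y> = Re<x,iy>]. *)
Lemma rip_adjoint (a b : H -> H) : linear a ->
  (forall x y, rip (a x) y = rip x (b y)) -> is_adjoint a b.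
Proof.
move=> la ab x y.
have aZ k u : a (k *: u) = k *: a u.
  have a0 : a 0 = 0 by have := la (-1) 0 0; rewrite scaler0 addr0 scaleN1r addNr.
  by have := la k u 0; rewrite !addr0 a0 addr0.
have := ab x y; have := ab ('i *: x) y; rewrite aZ /rip !linearZl_LR /=.
case: (inner (a x) y) (inner x (b y)) => u v [u' v'] /=.
by rewrite !mul0r !mul1r !sub0r => /oppr_inj -> ->.
Qed.

Lemma adjoint_rip (a b : H -> H) : is_adjoint a b ->
  forall x y, rip (a x) y = rip x (b y).
Proof. by move=> ab x y; rewrite /rip ab. Qed.

Lemma adjoint_rip' (a b : H -> H) : is_adjoint a b ->
  forall x y, rip (b x) y = rip x (a y).
Proof. by move=> ab x y; rewrite rip_sym -(adjoint_rip ab) rip_sym. Qed.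

End RealInnerProduct.

(* Linear identities between vectors are checked against all inner products. *)
Ltac vec_ring :=
  apply: rip_ext => ?; rewrite ?(ripDl, ripNl, ripZl, rip0l); ring.

(** * Square roots in a C*-algebra *)

Section LinearMaps.
Variables (R : realType) (H : hilbertType R).
Implicit Types (a : H -> H).

Lemma linop0 a : linear a -> a 0 = 0.
Proof. by move=> la; have := la (-1) 0 0; rewrite scaler0 addr0 scaleN1r addNr. Qed.

Lemma linopZ a k u : linear a -> a (k *: u) = k *: a u.
Proof. by move=> la; have := la k u 0; rewrite !addr0 (linop0 la) addr0. Qed.

Lemma linopD a u v : linear a -> a (u + v) = a u + a v.
Proof. by move=> la; have := la 1 u v; rewrite !scale1r. Qed.

Lemma linopN a u : linear a -> a (- u) = - a u.
Proof. by move=> la; rewrite -scaleN1r linopZ // scaleN1r. Qed.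

Lemma linopB a u v : linear a -> a (u - v) = a u - a v.
Proof. by move=> la; rewrite linopD // linopN. Qed.

Lemma linop_sum a (I : Type) (s : seq I) (P : pred I) (F : I -> H) : linear a ->
  a (\sum_(i <- s | P i) F i) = \sum_(i <- s | P i) a (F i).
Proof.
move=> la; elim/big_rec2: _ => [|i u v _ <-]; first exact: linop0.
exact: linopD.
Qed.

Lemma scaleCD (r s : R) (x : H) : (r + s)%:C *: x = r%:C *: x + s%:C *: x.
Proof. by rewrite rmorphD scalerDl. Qed.

Lemma scaleCM (r s : R) (x : H) : (r * s)%:C *: x = r%:C *: (s%:C *: x).
Proof. by rewrite rmorphM scalerA. Qed.

Definition rself_adjoint a : Prop := forall x y, rip (a x) y = rip x (a y).

Definition form_positive a : Prop := forall y, 0 <= rip (a y) y.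

(** Completeness with an explicit rate: the limit inherits the bound [e n], so pointwise limits of
    operators keep a rate that is uniform in the vector. *)
Lemma hilbert_limit (f : nat -> H) (e : nat -> R) :
  (forall n m, (n <= m)%N -> rn (f m - f n) <= e n) ->
  (forall eps, 0 < eps -> exists n, e n < eps) ->
  exists l, forall n, rn (l - f n) <= e n.
Proof.
move=> fe e0.
have fcvg : cvg (f n @[n --> \oo]).
  apply: cauchy_cvg; apply: cauchy_exP => eps eps0.
  have epsE : eps = (complex.Re eps)%:C by rewrite RRe_real // gtr0_real.
  have /e0[n en] : 0 < complex.Re eps by rewrite -ltcR -epsE.
  exists (f n); exists n => //= m /= nm.
  rewrite -ball_normE /= -opprB normrN normE epsE ltcR.
  exact: le_lt_trans (fe _ _ nm) en.
exists (lim (f n @[n --> \oo])) => n; set l := lim _.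
rewrite leNgt; apply/negP => lt_e.
have d0 : 0 < rn (l - f n) - e n by rewrite subr_gt0.
have /cvgrPdist_lt/(_ (rn (l - f n) - e n)%:C) := fcvg.
rewrite ltcR => /(_ d0) [k _ /(_ (maxn k n))] /=.
rewrite leq_maxl => /(_ isT); rewrite normE ltcR -/l => h.
have := fe _ _ (leq_maxr k n); set m := maxn k n in h *.
have := rnD (l - f m) (f m - f n); rewrite subrKA; lra.
Qed.

Definition peval (q : {poly R}) a (y : H) : H :=
  \sum_(i < size q) (q`_i)%:C *: iter i a y.

Lemma pevalE n (q : {poly R}) a y : (size q <= n)%N ->
  peval q a y = \sum_(i < n) (q`_i)%:C *: iter i a y.
Proof.
move=> qn; rewrite /peval (big_ord_widen _ (fun i => (q`_i)%:C *: iter i a y) qn).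
rewrite big_mkcond; apply: eq_bigr => i _; case: ltnP => // qi.
by rewrite nth_default // scale0r.
Qed.

Lemma pevalD (p q : {poly R}) a y : peval (p + q) a y = peval p a y + peval q a y.
Proof.
have h := leq_maxl (size p) (size q); have h' := leq_maxr (size p) (size q).
rewrite (pevalE _ _ (size_polyD p q)) (pevalE _ _ h) (pevalE _ _ h') -big_split /=.
by apply: eq_bigr => i _; rewrite coefD scaleCD.
Qed.

Lemma pevalZ c (q : {poly R}) a y : peval (c *: q) a y = c%:C *: peval q a y.
Proof.
rewrite (pevalE _ _ (size_scale_leq c q)) /peval scaler_sumr.
by apply: eq_bigr => i _; rewrite coefZ scaleCM.
Qed.

Lemma pevalN (q : {poly R}) a y : peval (- q) a y = - peval q a y.
Proof. by rewrite -scaleN1r pevalZ rmorphN1 scaleN1r. Qed.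

Lemma pevalB (p q : {poly R}) a y : peval (p - q) a y = peval p a y - peval q a y.
Proof. by rewrite pevalD pevalN. Qed.

Lemma pevalC c a y : peval c%:P a y = c%:C *: y.
Proof. by rewrite (pevalE _ _ (size_polyC_leq1 c)) big_ord1 coefC. Qed.

Lemma peval0 a y : peval 0 a y = 0.
Proof. by rewrite -polyC0 pevalC scale0r. Qed.

Lemma pevalMX (p : {poly R}) a y : peval (p * 'X) a y = peval p a (a y).
Proof.
have h : (size (p * 'X)%R <= (size p).+1)%N.
  by rewrite (leq_trans (size_polyMleq _ _)) // size_polyX addn2.
rewrite (pevalE _ _ h) big_ord_recl coefMX /= scale0r add0r.
by apply: eq_bigr => i _; rewrite coefMX /= add0n -iterS iterSr.
Qed.

Lemma pevalX a y : peval 'X a y = a y.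
Proof. by rewrite -[X in peval X]mul1r pevalMX -polyC1 pevalC scale1r. Qed.

Lemma peval_comm (p : {poly R}) a y : linear a -> a (peval p a y) = peval p a (a y).
Proof.
move=> la; rewrite linop_sum //; apply: eq_bigr => i _.
by rewrite linopZ // -iterS iterSr.
Qed.

Lemma peval_linear (p : {poly R}) a : linear a -> linear (peval p a).
Proof.
move=> la k u v; rewrite /peval scaler_sumr -big_split; apply: eq_bigr => i _ /=.
have -> : iter i a (k *: u + v) = k *: iter i a u + iter i a v.
  by elim: (i : nat) => //= j ->; rewrite la.
by rewrite scalerDr !scalerA mulrC.
Qed.

Lemma pevalM (p q : {poly R}) a y : linear a ->
  peval (p * q) a y = peval p a (peval q a y).
Proof.
move=> la; elim/poly_ind: p y => [|p c IH] y; first by rewrite mul0r !peval0.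
rewrite mulrDl mul_polyC !pevalD pevalZ pevalC -mulrA [X in p * X]mulrC mulrA.
by rewrite !pevalMX IH peval_comm.
Qed.

Lemma peval_self_adjoint (p : {poly R}) a : rself_adjoint a -> rself_adjoint (peval p a).
Proof.
move=> sa x y; rewrite /peval rip_suml rip_sumr; apply: eq_bigr => i _.
rewrite ripZl ripZr; congr (_ * _).
by elim: (i : nat) x y => // j IH x y; rewrite iterS sa IH -iterSr.
Qed.

(** Nonnegative coefficients reduce norm estimates for polynomials in a contraction to scalar values
    at 1. *)
Lemma peval_bound (p : {poly R}) a y : (forall i, 0 <= p`_i) ->
  (forall y, rn (a y) <= rn y) -> rn (peval p a y) <= p.[1] * rn y.
Proof.
move=> p0 ca; rewrite horner_coef mulr_suml.
apply: le_trans (rn_sum _ _ _) _; apply: ler_sum => i _.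
rewrite expr1n mulr1 rnZ ger0_norm // ler_wpM2l //.
by elim: (i : nat) => //= j; apply: le_trans.
Qed.

End LinearMaps.

(* The polynomials [sqrt_poly n] increase coefficientwise to the power series
   of [1 - sqrt (1 - 'X)]. *)
Section SquareRootPolynomials.
Variable R : realType.

Fixpoint sqrt_poly (n : nat) : {poly R} :=
  if n is m.+1 then 2^-1 *: ('X + sqrt_poly m ^+ 2) else 0.

Lemma sqrt_poly_ge0 n i : 0 <= (sqrt_poly n)`_i.
Proof.
elim: n i => [|n IH] i /=; first by rewrite coef0.
rewrite coefZ coefD coefX expr2 coefM mulr_ge0 ?invr_ge0 // addr_ge0 //.
by apply: sumr_ge0 => j _; rewrite mulr_ge0.
Qed.

(** A fixed point of z -> (X + z^2)/2 satisfies (1 - z)^2 = 1 - X. Consecutive differences obey z''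
    - z' = (z' - z)(z' + z)/2, so their coefficients stay nonnegative. *)
Lemma sqrt_poly_le n m i : (n <= m)%N -> 0 <= (sqrt_poly m - sqrt_poly n)`_i.
Proof.
have step k j : 0 <= (sqrt_poly k.+1 - sqrt_poly k)`_j.
  elim: k j => [|k IH] j; first by rewrite subr0 sqrt_poly_ge0.
  have -> : sqrt_poly k.+2 - sqrt_poly k.+1 =
      2^-1 *: ((sqrt_poly k.+1 - sqrt_poly k) * (sqrt_poly k.+1 + sqrt_poly k)).
    rewrite [LHS]/= -[2^-1 *: ('X + sqrt_poly k ^+ 2)]/(sqrt_poly k.+1).
    rewrite {2}[sqrt_poly k.+1]/= -scalerBr; congr (_ *: _); ring.
  rewrite coefZ coefM mulr_ge0 ?invr_ge0 //.
  by apply: sumr_ge0 => l _; rewrite mulr_ge0 // coefD addr_ge0 // sqrt_poly_ge0.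
elim: m => [|m IH]; first by rewrite leqn0 => /eqP ->; rewrite subrr coef0.
rewrite leq_eqVlt => /orP[/eqP ->|/IH h]; first by rewrite subrr coef0.
by rewrite -(subrKA (sqrt_poly m)) coefD addr_ge0.
Qed.

Lemma sqrt_poly_horner1 n : 0 <= (sqrt_poly n).[1] <= 1.
Proof.
apply/andP; split.
  rewrite horner_coef; apply: sumr_ge0 => i _.
  by rewrite expr1n mulr1 sqrt_poly_ge0.
elim: n => [|n IH] /=; first by rewrite horner0.
have g0 : 0 <= (sqrt_poly n).[1].
  rewrite horner_coef; apply: sumr_ge0 => i _.
  by rewrite expr1n mulr1 sqrt_poly_ge0.
rewrite hornerZ hornerD hornerX horner_exp; nra.
Qed.

End SquareRootPolynomials.

Section SquareRoot.
Variables (R : realType) (H : hilbertType R) (A : set (H -> H)).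
Hypothesis hA : unital_cstar_algebra A.

Lemma cstar_linear a : A a -> linear a.
Proof. by move=> /(cstar_bounded hA)[]. Qed.

Lemma cstar_bound a : A a -> exists2 L : R, 0 <= L & forall y, rn (a y) <= L * rn y.
Proof.
move=> /(cstar_bounded hA)[_ [M hM]]; exists `|complex.Re M| => // y.
have := hM y; rewrite !normE.
have -> : M * (rn y)%:C = (complex.Re M * rn y) +i* (complex.Im M * rn y).
  by case: M {hM} => u v; congr Complex; rewrite /= mulr0 ?subr0 ?add0r.
rewrite lecE /= => /andP[_ h]; apply: (le_trans h).
by rewrite ler_wpM2r ?rn_ge0 // ler_norm.
Qed.

Lemma cstar_ext a b : A a -> a =1 b -> A b.
Proof. by move=> Aa /funext <-. Qed.

Lemma cstar_zero : A (fun _ => 0).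
Proof.
apply: (cstar_ext (cstar_scale hA 0 (cstar_unit hA))) => y /=.
by rewrite fctE scale0r.
Qed.

Lemma cstar_sub a b : A a -> A b -> A (fun y => a y - b y).
Proof.
move=> Aa Ab; apply: (cstar_ext (cstar_add hA Aa (cstar_scale hA (-1) Ab))) => y.
by rewrite !fctE scaleN1r.
Qed.

Lemma cstar_sum (I : Type) (s : seq I) (P : pred I) (F : I -> H -> H) :
  (forall i, A (F i)) -> A (fun y => \sum_(i <- s | P i) F i y).
Proof.
move=> AF; elim: s => [|i s IH].
  by apply: (cstar_ext cstar_zero) => y; rewrite big_nil.
case Pi: (P i); last by apply: (cstar_ext IH) => y; rewrite big_cons Pi.
by apply: (cstar_ext (cstar_add hA (AF i) IH)) => y; rewrite big_cons Pi.
Qed.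

Lemma cstar_iter a n : A a -> A (iter n a).
Proof.
by move=> Aa; elim: n => [|n IH]; [exact: (cstar_unit hA)|exact: (cstar_mul hA)].
Qed.

Lemma cstar_peval (q : {poly R}) a : A a -> A (peval q a).
Proof.
move=> Aa; rewrite /peval; apply: (@cstar_sum _ _ _ (fun i : 'I_(size q) => fun y => (q`_i)%:C *: iter i a y)).
by move=> i; apply: (cstar_scale hA); apply: cstar_iter.
Qed.

Lemma cstar_adjoint a : A a -> A (adj a) /\ is_adjoint a (adj a).
Proof. by move=> /(cstar_adj hA)[b Ab ab]; rewrite (adjE ab). Qed.

(** S = 1 - Z, where Z is the limit of [sqrt_poly n] evaluated at X. The rate is read off at 1,
    where the values increase and are bounded by 1. The last clause, approximation of S by
    polynomials in X, lets commutation relations and moment bounds pass to S. *)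
Lemma cstar_sqrt X : A X -> rself_adjoint X -> (forall y, rn (X y) <= rn y) ->
  exists S, [/\ A S, rself_adjoint S, form_positive S,
    forall y, S (S y) = y - X y &
    forall eps, 0 < eps ->
      exists q : {poly R}, forall y, rn (S y - peval q X y) <= eps * rn y].
Proof.
move=> AX saX cX; have lX := cstar_linear AX.
pose u n := (sqrt_poly R n).[1].
have ubu : ubound (range u) 1 by move=> _ [n _ <-]; have /andP[] := sqrt_poly_horner1 R n.
have su : has_sup (range u) by split; [exists (u 0%N); exists 0%N | exists 1].
pose e n := sup (range u) - u n.
have e_ge0 n : 0 <= e n.
  by rewrite subr_ge0; apply: ub_le_sup; [exists 1 | exists n].
have e_small eps : 0 < eps -> exists n, e n < eps.
  move=> /(sup_adherent)/(_ su)[_ [n _ <-]] h; exists n; rewrite /e; lra.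
have u1 n : u n + e n <= 1 by rewrite /e addrC subrK; apply: ge_sup => //; exists (u 0%N); exists 0%N.
pose z n := peval (sqrt_poly R n) X.
have zB n m y : (n <= m)%N -> rn (z m y - z n y) <= e n * rn y.
  move=> nm; rewrite /z -pevalB; apply: le_trans (peval_bound _ _ cX) _.
    by move=> i; apply: sqrt_poly_le.
  rewrite hornerD hornerN ler_wpM2r ?rn_ge0 // lerD2r.
  by apply: ub_le_sup; [exists 1 | exists m].
have z1 n y : rn (z n y) <= rn y.
  apply: le_trans (peval_bound _ _ cX) _; first exact: sqrt_poly_ge0.
  by rewrite ler_piMl ?rn_ge0 //; have /andP[] := sqrt_poly_horner1 R n.
have /choice[Z hZ] y : exists l, forall n, rn (l - z n y) <= e n * rn y.
  apply: hilbert_limit => [n m nm|eps eps0]; first exact: zB.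
  have [n en] := e_small (eps / (rn y + 1)) (divr_gt0 eps0 (ltr_wpDl (rn_ge0 y) ltr01)).
  exists n; rewrite ltr_pdivlMr ?ltr_wpDl ?rn_ge0 // in en.
  by apply: le_lt_trans en; rewrite ler_wpM2l // lerDl.
(* Identities for the limit Z are proved by bounding the defect by a multiple of every [e n]. *)
have null C (v : H) : (forall n, rn v <= e n * C) -> v = 0.
  move=> h; apply: rn_eq0; apply/eqP; rewrite eq_le rn_ge0 andbT.
  rewrite leNgt; apply/negP => v0.
  have C0 : 0 < C.
    have [//|C0] := ltP 0 C; have := h 0%N.
    by have := mulr_ge0_le0 (e_ge0 0%N) C0; lra.
  have [n en] := e_small _ (divr_gt0 v0 C0).
  by move: en; rewrite ltr_pdivlMr // ltNge h.
have lz n : linear (z n) by apply: peval_linear.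
have lZ : linear Z.
  move=> k x y; apply/eqP; rewrite -subr_eq0; apply/eqP.
  apply: (null (rn (k *: x + y) + (complex.Re `|k| * rn x + rn y)) _) => n.
  have -> : Z (k *: x + y) - (k *: Z x + Z y) =
      (Z (k *: x + y) - z n (k *: x + y)) - (k *: (Z x - z n x) + (Z y - z n y)).
    by rewrite lz scalerBr; vec_ring.
  apply: (le_trans (rnB _ _)); rewrite mulrDr lerD //.
  apply: (le_trans (rnD _ _)); rewrite mulrDr lerD //.
  by rewrite rnZc mulrCA ler_wpM2l // -ler0c RRe_real ?normr_real.
have Z1 y : rn (Z y) <= rn y.
  have := rnD (Z y - z 0%N y) (z 0%N y); rewrite subrK => h.
  have h0 : z 0%N y = 0 by rewrite /z peval0.
  rewrite h0 rn0 in h; have := hZ y 0%N; rewrite h0 subr0 => h1.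
  have := u1 0%N; rewrite /u horner0 add0r => h2.
  by apply: (le_trans h1); rewrite ler_piMl ?rn_ge0.
(* The fixed-point equation of the iteration passes to the limit; it is (1 - Z)^2 = 1 - X. *)
have ZZ y : (2 : R)%:C *: Z y = X y + Z (Z y).
  apply/eqP; rewrite -subr_eq0; apply/eqP; apply: (null (4 * rn y)) => n.
  have zS : z n.+1 y = (2^-1 : R)%:C *: (X y + z n (z n y)).
    by rewrite /z /= pevalZ pevalD pevalX expr2 pevalM.
  have {}zS : (2 : R)%:C *: z n.+1 y = X y + z n (z n y).
    by rewrite zS -scaleCM divff ?pnatr_eq0 // scale1r.
  have -> : (2 : R)%:C *: Z y - (X y + Z (Z y)) =
    (2 : R)%:C *: (Z y - z n.+1 y) - ((Z (Z y) - z n (Z y)) + z n (Z y - z n y)).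
    by rewrite scalerBr zS linopB //; vec_ring.
  have en : e n.+1 <= e n.
    rewrite /e lerD2l lerN2 -subr_ge0 /u -hornerN -hornerD horner_coef.
    by apply: sumr_ge0 => i _; rewrite expr1n mulr1 sqrt_poly_le.
  apply: (le_trans (rnB _ _)).
  have h1 : rn ((2 : R)%:C *: (Z y - z n.+1 y)) <= 2 * (e n * rn y).
    rewrite rnZ ger0_norm // ler_wpM2l //; apply: (le_trans (hZ _ _)).
    by rewrite ler_wpM2r ?rn_ge0.
  have h2 := rnD (Z (Z y) - z n (Z y)) (z n (Z y - z n y)).
  have h3 : rn (Z (Z y) - z n (Z y)) <= e n * rn y.
    by apply: (le_trans (hZ _ _)); rewrite ler_wpM2l.
  have h4 : rn (z n (Z y - z n y)) <= e n * rn y by apply: le_trans (z1 _ _) (hZ _ _).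
  lra.
have saZ : rself_adjoint Z.
  move=> x y; apply/eqP; rewrite -subr_eq0; apply/eqP/normr0_eq0/eqP.
  rewrite eq_le normr_ge0 andbT leNgt; apply/negP => d0.
  set d := `| _ | in d0.
  have C0 : 0 < 2 * (rn x * rn y) + 1.
    by rewrite ltr_wpDl // mulr_ge0 // mulr_ge0 ?rn_ge0.
  have [n] := e_small _ (divr_gt0 d0 C0); rewrite ltr_pdivlMr // mulrDr mulr1 => en.
  have sz : rip (z n x) y = rip x (z n y) by apply: peval_self_adjoint.
  have dE : rip (Z x) y - rip x (Z y) = rip (Z x - z n x) y - rip x (Z y - z n y).
    rewrite ripDl ripDr ripNl ripNr sz; ring.
  have h1 := ler_normB (rip (Z x - z n x) y) (rip x (Z y - z n y)).
  rewrite -dE -/d in h1.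
  have h2 : `|rip (Z x - z n x) y| <= e n * (rn x * rn y).
    apply: (le_trans (normr_rip_le _ _)); rewrite mulrA ler_wpM2r ?rn_ge0 //.
  have h3 : `|rip x (Z y - z n y)| <= e n * (rn x * rn y).
    by apply: (le_trans (normr_rip_le _ _)); rewrite mulrCA ler_wpM2l ?rn_ge0.
  have := e_ge0 n; lra.
exists (fun y => y - Z y).
have approx eps : 0 < eps -> exists q : {poly R},
    forall y, rn ((y - Z y) - peval q X y) <= eps * rn y.
  move=> /e_small[n en]; exists (1 - sqrt_poly R n) => y.
  have -> : y - Z y - peval (1 - sqrt_poly R n) X y = - (Z y - z n y).
    by rewrite pevalB -polyC1 pevalC scale1r -/(z n y); vec_ring.
  by rewrite rnN; apply: (le_trans (hZ _ _)); rewrite ler_wpM2r ?rn_ge0 // ltW.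
have lS : linear (fun y => y - Z y).
  by move=> k x y; rewrite lZ scalerBr opprD addrACA.
split=> //.
- apply: (cstar_closed hA).
    split=> //; exists (2 : R)%:C => y; rewrite !normE -rmorphM lecR.
    by apply: (le_trans (rnB _ _)); have := Z1 y; lra.
  move=> eps /approx[q hq]; exists (peval q X); first exact: cstar_peval.
  by move=> y; rewrite !normE -rmorphM lecR.
- by move=> x y; rewrite ripDl ripDr ripNl ripNr saZ.
- move=> y; rewrite ripDl ripNl -/(sqn y) sqnE subr_ge0.
  by apply: (le_trans (rip_le _ _)); rewrite expr2 ler_wpM2r ?rn_ge0.
- move=> y; have -> : y - X y = y + Z (Z y) - (2 : R)%:C *: Z y.
    by rewrite ZZ; vec_ring.
  by rewrite linopB //; vec_ring.
Qed.

End SquareRoot.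

(** * Faithful states *)

Section RealLemmas.
Variable R : realType.
Implicit Types (x z : R).

(** The source of the Cauchy-Schwarz inequalities for semidefinite forms below; c = 0 must be
    allowed. *)
Lemma discriminant_le (a b c : R) : 0 <= c ->
  (forall u, 0 <= a + 2 * u * b + u ^+ 2 * c) -> b ^+ 2 <= a * c.
Proof.
move=> c0 h; have [cE|c_neq0] := eqVneq c 0.
  have [->|b0] := eqVneq b 0; first by rewrite cE expr0n /= mulr0.
  (* The affine function takes the value -1 here. *)
  have := h (- (a + 1) / (2 * b)); rewrite cE mulr0 addr0.
  have -> : 2 * (- (a + 1) / (2 * b)) * b = - (a + 1) by field.
  by move=> ?; exfalso; lra.
have cp : 0 < c by rewrite lt0r c_neq0.
have := h (- b / c); have -> : a + 2 * (- b / c) * b + (- b / c) ^+ 2 * c =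
  (a * c - b ^+ 2) / c by field.
by rewrite pmulr_lge0 ?invr_gt0 // subr_ge0.
Qed.

Lemma bernoulli x n : 0 <= x -> 1 + n%:R * x <= (1 + x) ^+ n.
Proof.
move=> x0; elim: n => [|n IH]; first by rewrite mul0r addr0 expr0.
rewrite exprS -natr1.
have : (1 + x) * (1 + n%:R * x) <= (1 + x) * (1 + x) ^+ n by rewrite ler_wpM2l //; lra.
have : 0 <= n%:R * (x * x) by rewrite !mulr_ge0.
lra.
Qed.

(* Only the exponential growth rates of the two sides matter. *)
Lemma le_of_pow2_bound x z (C : R) : 0 <= z ->
  (forall j, x ^+ (2 ^ j) <= C * z ^+ (2 ^ j)) -> x <= z.
Proof.
move=> z0 h; rewrite leNgt; apply/negP => zx.
have [zE|z_neq0] := eqVneq z 0.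
  have := h 0%N; rewrite zE expr0n /= mulr0 expr1; lra.
have zp : 0 < z by rewrite lt0r z_neq0.
have d0 : 0 < x / z - 1 by rewrite subr_gt0 ltr_pdivlMr // mul1r.
have [n hn] : exists n : nat, C < n%:R * (x / z - 1).
  exists (Num.bound `|C / (x / z - 1)|).
  rewrite -ltr_pdivrMr //; apply: le_lt_trans (ler_norm _) _.
  exact: archi_boundP.
have := h n; rewrite -ler_pdivrMr ?exprn_gt0 // -expr_div_n => hC.
have b := bernoulli (2 ^ n) (ltW d0); rewrite subrKC in b.
have : n%:R * (x / z - 1) <= (2 ^ n)%:R * (x / z - 1).
  by rewrite ler_wpM2r ?(ltW d0) // ler_nat ltnW // ltn_expl.
by lra.
Qed.

End RealLemmas.

Section State.
Variables (R : realType) (H : hilbertType R) (A : set (H -> H)).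
Variable tau : (H -> H) -> R[i].
Hypothesis hA : unital_cstar_algebra A.
Hypothesis htau : state_on A tau.
Implicit Types (a b T : H -> H) (q : {poly R}).

Definition rtau a : R := complex.Re (tau a).

Lemma rtauD a b : A a -> A b -> rtau (fun y => a y + b y) = rtau a + rtau b.
Proof.
move=> Aa Ab; have := state_linear htau 1 Aa Ab.
by rewrite scale1r mul1r /rtau => ->; rewrite raddfD.
Qed.

Lemma rtau0 : rtau (fun _ => 0) = 0.
Proof.
have := rtauD (cstar_zero hA) (cstar_zero hA).
have -> : (fun _ : H => 0 + 0) = (fun _ => 0 : H) by apply/funext => y; rewrite addr0.
by move/eqP; rewrite -subr_eq subrr eq_sym => /eqP.
Qed.

Lemma rtauZ (r : R) a : A a -> rtau (fun y => r%:C *: a y) = r * rtau a.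
Proof.
move=> Aa; have := state_linear htau r%:C Aa (cstar_zero hA).
have -> : r%:C *: a + (fun=> 0) = (fun y => r%:C *: a y).
  by apply/funext => y; rewrite !fctE addr0.
rewrite /rtau => ->; have := rtau0; rewrite /rtau.
case: (tau _) => u v /= ->; case: (tau a) => u' v' /=; ring.
Qed.

Lemma rtauB a b : A a -> A b -> rtau (fun y => a y - b y) = rtau a - rtau b.
Proof.
move=> Aa Ab; have Ab' : A (fun y => (-1 : R)%:C *: b y) by apply: (cstar_scale hA).
have -> : (fun y => a y - b y) = (fun y => a y + (-1 : R)%:C *: b y).
  by apply/funext => y; vec_ring.
by rewrite rtauD // rtauZ // mulN1r.
Qed.

Lemma rtau_sum (I : Type) (s : seq I) (P : pred I) (F : I -> H -> H) :
  (forall i, A (F i)) ->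
  rtau (fun y => \sum_(i <- s | P i) F i y) = \sum_(i <- s | P i) rtau (F i).
Proof.
move=> AF; elim: s => [|i s IH].
  rewrite big_nil -rtau0; congr rtau; apply/funext => y; exact: big_nil.
rewrite big_cons -IH; case Pi: (P i).
  rewrite -rtauD //; last exact: cstar_sum.
  by congr rtau; apply/funext => y; rewrite big_cons Pi.
by congr rtau; apply/funext => y; rewrite big_cons Pi.
Qed.

Lemma rtau_id : rtau id = 1.
Proof. by rewrite /rtau (state_unit htau). Qed.

Lemma rtau_adj_comp_ge0 a b : A a -> is_adjoint a b -> 0 <= rtau (fun y => b (a y)).
Proof.
move=> Aa ab; have := state_pos htau Aa; rewrite (adjE ab) lecE => /andP[_].
by rewrite /rtau.
Qed.

(** The operator inequality a^2 <= L a for 0 <= a <= L. It follows from positivity of the form at y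
    - a y / L alone, without a square root. *)
Lemma form_positive_sqn_le a (L : R) : rself_adjoint a -> linear a -> form_positive a ->
  0 < L -> (forall y, rn (a y) <= L * rn y) ->
  forall y, sqn (a y) <= L * rip (a y) y.
Proof.
move=> sa la pa L0 aL y.
have := pa (y - L^-1%:C *: a y).
rewrite linopB // linopZ // !(ripDl, ripDr, ripNl, ripNr, ripZl, ripZr).
rewrite (sa (a y) y) -/(sqn (a y)) => h.
have h2 : rip (a (a y)) (a y) <= L * sqn (a y).
  apply: (le_trans (rip_le _ _)); rewrite sqnE expr2 mulrA ler_wpM2r ?rn_ge0 //.
have L1 : L^-1 * L = 1 by rewrite mulVf // gt_eqF.
have L2 : 0 < L^-1 by rewrite invr_gt0.
have h3 : L^-1 * (L^-1 * rip (a (a y)) (a y)) <= L^-1 * sqn (a y).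
  by rewrite ler_wpM2l ?(ltW L2) // mulrC ler_pdivrMr // mulrC.
have h4 : L^-1 * sqn (a y) <= rip (a y) y.
  lra.
by rewrite -ler_pdivrMl.
Qed.

(** This makes X = 1 - a / L admissible in [cstar_sqrt], whose output is then a square root of a /
    L. *)
Lemma form_positive_contraction a (L : R) : rself_adjoint a -> linear a ->
  form_positive a -> 0 < L -> (forall y, rn (a y) <= L * rn y) ->
  forall y, rn (y - L^-1%:C *: a y) <= rn y.
Proof.
move=> sa la pa L0 aL y; have h := form_positive_sqn_le sa la pa L0 aL y.
rewrite -(@ler_pXn2r _ 2) ?nnegrE ?rn_ge0 // -!sqnE sqnD sqnN sqnZ ripNr ripZr.
rewrite (rip_sym y) expr2 -mulrA.
have : L^-1 * (L^-1 * sqn (a y)) <= L^-1 * rip (a y) y.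
  by rewrite ler_wpM2l ?invr_ge0 ?(ltW L0) // mulrC ler_pdivrMr // mulrC.
have := mulr_ge0 (ltW L0) (pa y).
have : 0 <= L^-1 * rip (a y) y by rewrite mulr_ge0 ?invr_ge0 ?(ltW L0).
lra.
Qed.

Lemma cstar_bound_gt0 a : A a -> exists2 L : R, 0 < L & forall y, rn (a y) <= L * rn y.
Proof.
move=> /(cstar_bound hA)[L L0 aL]; exists (L + 1); first lra.
by move=> y; apply: (le_trans (aL y)); rewrite ler_wpM2r ?rn_ge0 //; lra.
Qed.

Lemma cstar_positive_sqrt T : A T -> rself_adjoint T -> form_positive T ->
  exists s, [/\ A s, rself_adjoint s & forall y, s (s y) = T y].
Proof.
move=> AT sT pT; have lT := cstar_linear hA AT.
have [L L0 TL] := cstar_bound_gt0 AT.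
have cX := form_positive_contraction sT lT pT L0 TL.
have AZ : A (fun y => L^-1%:C *: T y) by apply: (cstar_scale hA).
have AX := cstar_sub hA (cstar_unit hA) AZ.
have sX : rself_adjoint (fun y => y - L^-1%:C *: T y).
  by move=> x y; rewrite ripDl ripDr ripNl ripNr ripZl ripZr sT.
have [S [AS sS pS SS _]] := cstar_sqrt hA AX sX cX.
exists (fun y => (Num.sqrt L)%:C *: S y); split.
- exact: (cstar_scale hA).
- by move=> x y; rewrite ripZl ripZr sS.
move=> y; rewrite (linopZ _ _ (cstar_linear hA AS)) SS opprB subrKC.
by rewrite -!scaleCM -expr2 sqr_sqrtr ?ltW // divff ?scale1r // gt_eqF.
Qed.

Lemma rself_adjoint_adjoint T : linear T -> rself_adjoint T -> is_adjoint T T.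
Proof. exact: rip_adjoint. Qed.

Lemma is_adjoint_comp a a' b b' : is_adjoint a a' -> is_adjoint b b' ->
  is_adjoint (fun y => a (b y)) (fun y => b' (a' y)).
Proof. by move=> aa bb x y; rewrite aa bb. Qed.

(** A state is only known to be nonnegative on products c^* c. Writing T = s^2 inside the algebra
    exhibits b^* T b as such a product, with c = s b. *)
Lemma rtau_positive T b b' : A T -> rself_adjoint T -> form_positive T ->
  A b -> is_adjoint b b' -> 0 <= rtau (fun y => b' (T (b y))).
Proof.
move=> AT sT pT Ab bb'; have [s [As ss sE]] := cstar_positive_sqrt AT sT pT.
have := rtau_adj_comp_ge0 (cstar_mul hA As Ab)
  (is_adjoint_comp (rself_adjoint_adjoint (cstar_linear hA As) ss) bb').
by under eq_fun do rewrite sE.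
Qed.

Lemma rtau_le (D : H -> H) (d : R) : A D -> rself_adjoint D ->
  (forall y, rn (D y) <= d * rn y) -> rtau D <= d.
Proof.
move=> AD sD Dd; have AI : A (fun y => d%:C *: y) := cstar_scale hA d%:C (cstar_unit hA).
have := @rtau_positive (fun y => d%:C *: y - D y) id id (cstar_sub hA AI AD) _ _ (cstar_unit hA).
rewrite rtauB // (rtauZ _ (cstar_unit hA)) rtau_id mulr1 subr_ge0; apply=> //.
- by move=> x y; rewrite ripDl ripDr ripNl ripNr ripZl ripZr sD.
- move=> y; rewrite ripDl ripNl ripZl subr_ge0; apply: (le_trans (rip_le _ _)).
  by rewrite -/(sqn y) sqnE expr2 mulrA ler_wpM2r ?rn_ge0.
Qed.

Lemma peval_comp_poly (q r : {poly R}) a y : linear a ->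
  peval (q \Po r) a y = peval q (peval r a) y.
Proof.
move=> la; elim/poly_ind: q y => [|q c IH] y; first by rewrite comp_poly0 !peval0.
rewrite comp_polyD comp_polyM comp_polyX comp_polyC !pevalD !pevalC (pevalM _ r _ la).
by rewrite (pevalM q 'X _ (peval_linear r la)) pevalX IH.
Qed.

Section Moments.
Variable T : H -> H.
Hypotheses (AT : A T) (sT : rself_adjoint T) (pT : form_positive T).
Let lT : linear T := cstar_linear hA AT.

Let l q : R := rtau (peval q T).

Let lD p q : l (p + q) = l p + l q.
Proof.
rewrite /l -rtauD; [|exact: cstar_peval..].
by congr rtau; apply/funext => y; rewrite pevalD.
Qed.

Let lZ c q : l (c *: q) = c * l q.
Proof.
rewrite /l -rtauZ; last exact: cstar_peval.
by congr rtau; apply/funext => y; rewrite pevalZ.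
Qed.

Let l_sum n (F : 'I_n -> {poly R}) : l (\sum_(i < n) F i) = \sum_(i < n) l (F i).
Proof.
elim/big_rec2: _ => [|i u v _ <-]; last by rewrite lD.
by rewrite -(scale0r 0) lZ mul0r.
Qed.

Let l_sqr q : 0 <= l (q ^+ 2).
Proof.
have Aq := cstar_peval hA q AT.
have := rtau_adj_comp_ge0 Aq
  (rself_adjoint_adjoint (cstar_linear hA Aq) (peval_self_adjoint q sT)).
by congr (0 <= rtau _); apply/funext => y; rewrite expr2 pevalM.
Qed.

Let l_Xsqr q : 0 <= l ('X * q ^+ 2).
Proof.
have Aq := cstar_peval hA q AT.
have := rtau_positive AT sT pT Aq
  (rself_adjoint_adjoint (cstar_linear hA Aq) (peval_self_adjoint q sT)).
congr (0 <= rtau _); apply/funext => y.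
by rewrite expr2 mulrC -mulrA mulrC -mulrA pevalM // pevalM // pevalX.
Qed.

Let iterE n : l 'X^n = rtau (iter n T).
Proof.
congr rtau; apply/funext => y; elim: n => [|n IH].
  by rewrite expr0 -polyC1 pevalC scale1r.
by rewrite exprS pevalM // pevalX IH.
Qed.

Variable rho : R.
Hypothesis rho0 : 0 <= rho.
Hypothesis even_ratio :
  forall k, rtau (iter (k.*2).+1 T) <= rho * rtau (iter k.*2 T).

Let Xn_double n : 'X^(n.*2) = ('X^n) ^+ 2 :> {poly R}.
Proof. by rewrite -exprM muln2. Qed.

Let moment_ge0 n : 0 <= l 'X^n.
Proof.
rewrite -(odd_double_half n); case: (odd n) => /=.
  by rewrite add1n exprS Xn_double.
by rewrite add0n Xn_double.
Qed.

(** The missing ratios follow from log-convexity: with m_k the moments, m_(2j+2)^2 <= m_(2j+1)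
    m_(2j+3) <= rho m_(2j+1) m_(2j+2), and one factor cancels. *)
Let moment_le k : l 'X^k <= rho ^+ k.
Proof.
have step n : l 'X^(n.+1) <= rho * l 'X^n.
  rewrite -(odd_double_half n); set j := n./2; case: (odd n) => /=; last first.
    by rewrite add0n !iterE.
  rewrite add1n; set m1 := l 'X^(j.*2.+2); set m2 := l 'X^(j.*2.+1).
  have h : m1 ^+ 2 <= m2 * l 'X^(j.*2.+3).
    apply: discriminant_le => // u.
    have := l_Xsqr ('X^j + u *: 'X^(j.+1)).
    have -> : 'X * ('X^j + u *: 'X^(j.+1)) ^+ 2 =
      'X^(j.*2.+1) + (2 * u) *: 'X^(j.*2.+2) + (u ^+ 2) *: 'X^(j.*2.+3) :> {poly R}.
      rewrite !exprS Xn_double -!mul_polyC !polyCM; ring.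
    by rewrite !lD !lZ.
  have h2 : l 'X^(j.*2.+3) <= rho * m1 by rewrite /m1 !iterE; exact: (even_ratio j.+1).
  have := moment_ge0 (j.*2.+2); rewrite -/m1 le0r => /orP[/eqP -> |m1p].
    by rewrite mulr_ge0 // /m2.
  have : m1 * m1 <= (rho * m2) * m1.
    apply: (le_trans (y := m2 * l 'X^(j.*2.+3))); first by rewrite -expr2.
    by rewrite (mulrC rho) -mulrA ler_wpM2l // /m2.
  by rewrite ler_pM2r.
elim: k => [|k IH]; first by rewrite iterE /= rtau_id expr0.
by apply: (le_trans (step k)); rewrite exprS ler_wpM2l.
Qed.

(** In spectral terms, the measure of the moments lives on [0, rho]. Repeated Cauchy-Schwarz raises
    the ratio of l (X q^2) to l (q^2) to the power 2^j, while [moment_le] only allows growth of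
    order rho^(2^j). *)
Let quadratic_ratio q : l ('X * q ^+ 2) <= rho * l (q ^+ 2).
Proof.
set b := l (q ^+ 2); have b0 : 0 <= b := l_sqr q.
pose a j := l ('X^(2 ^ j) * q ^+ 2).
have CS j : a j ^+ 2 <= a j.+1 * b.
  rewrite mulrC; apply: discriminant_le.
    rewrite /a; have -> : 'X^(2 ^ j.+1) * q ^+ 2 = ('X^(2 ^ j) * q) ^+ 2.
      by rewrite exprMn -exprM expnSr.
    exact: l_sqr.
  move=> u; have := l_sqr (q + u *: ('X^(2 ^ j) * q)).
  have -> : (q + u *: ('X^(2 ^ j) * q)) ^+ 2 = q ^+ 2 + (2 * u) *: ('X^(2 ^ j) * q ^+ 2)
      + (u ^+ 2) *: ('X^(2 ^ j.+1) * q ^+ 2).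
    by rewrite expnSr exprM -!mul_polyC !polyCM; ring.
  by rewrite !lD !lZ.
have a0 : 0 <= a 0%N by rewrite /a expr1.
have aj j : (a 0%N) ^+ (2 ^ j) * b <= a j * b ^+ (2 ^ j).
  elim: j => [|j IH]; first by rewrite !expr1.
  have [->|b_neq0] := eqVneq b 0; first by rewrite expr0n expn_eq0 /= !mulr0.
  have bp : 0 < b by rewrite lt0r b_neq0.
  rewrite -(ler_pM2r bp) expnSr !exprM -mulrA -expr2 -exprMn.
  have l0 : 0 <= (a 0%N) ^+ (2 ^ j) * b by rewrite mulr_ge0 // exprn_ge0.
  apply: (le_trans (y := (a j * b ^+ (2 ^ j)) ^+ 2)).
    by rewrite ler_pXn2r // nnegrE // (le_trans l0 IH).
  by rewrite exprMn [leRHS]mulrAC ler_wpM2r // sqr_ge0.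
pose C := \sum_(i < size (q ^+ 2)) `|(q ^+ 2)`_i| * rho ^+ i.
have aC j : a j <= C * rho ^+ (2 ^ j).
  rewrite /a /C -{1}[q ^+ 2]coefK poly_def mulr_sumr l_sum mulr_suml.
  apply: ler_sum => i _; rewrite -scalerAr -exprD lZ -mulrA -exprD addnC.
  by apply: (le_trans (ler_norm _)); rewrite normrM ler_wpM2l // ger0_norm.
have -> : l ('X * q ^+ 2) = a 0%N by rewrite /a expr1.
have [bE|b_neq0] := eqVneq b 0.
  have := CS 0%N; rewrite bE !mulr0 => h.
  by have /eqP := le_anti (introT andP (conj h (sqr_ge0 (a 0%N)))); rewrite sqrf_eq0 => /eqP ->.
have bp : 0 < b by rewrite lt0r b_neq0.
apply: (@le_of_pow2_bound _ _ _ (C / b)); first by rewrite mulr_ge0.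
move=> j; rewrite mulrAC ler_pdivlMr //; apply: (le_trans (aj j)).
by rewrite exprMn mulrA ler_wpM2r // exprn_ge0.
Qed.

Hypothesis ftau : faithful_on A tau.

(* With [Y = T - rho], the operator [P = |Y| + Y] satisfies
   [tau (P Y P) = tau (P |Y| P) >= 0], while the moments bound [tau (P Y P)] by
   [0]; faithfulness then gives [P = 0]. *)
Lemma faithful_moments y : rip (T y) y <= rho * sqn y.
Proof.
pose Y := peval ('X - rho%:P) T.
have YE x : Y x = T x - rho%:C *: x by rewrite /Y pevalB pevalX pevalC.
have AY : A Y by apply: cstar_peval.
have sY : rself_adjoint Y by apply: peval_self_adjoint.
have lY := cstar_linear hA AY.
have [L L0 YL] := cstar_bound_gt0 AY.
have L_neq0 : L != 0 by rewrite gt_eqF.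
have AYY : A (fun x => Y (Y x)) by apply: (cstar_mul hA).
have pYY : form_positive (fun x => Y (Y x)) by move=> x; rewrite sY sqn_ge0.
have sYY : rself_adjoint (fun x => Y (Y x)) by move=> u v; rewrite !sY.
have L20 : 0 < L ^+ 2 by rewrite exprn_gt0.
have YYL x : rn (Y (Y x)) <= L ^+ 2 * rn x.
  by apply: (le_trans (YL _)); rewrite expr2 -mulrA ler_wpM2l ?(ltW L0).
have cX := form_positive_contraction sYY (cstar_linear hA AYY) pYY L20 YYL.
(* The square root of 1 - r(T) = Y^2 / L^2 is S = |Y| / L; likewise P below is (|Y| + Y) / L. *)
pose r : {poly R} := 1 - ((L ^+ 2)^-1) *: ('X - rho%:P) ^+ 2.
have rE : (fun x => x - (L ^+ 2)^-1%:C *: Y (Y x)) = peval r T.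
  apply/funext => x; rewrite /r pevalB -polyC1 pevalC scale1r pevalZ expr2.
  by rewrite pevalM.
have {}cX x : rn (peval r T x) <= rn x by rewrite -rE; exact: cX.
have [S [AS sS pS SS Sapprox]] :=
  cstar_sqrt hA (cstar_peval hA r AT) (peval_self_adjoint r sT) cX.
have lS := cstar_linear hA AS.
have {SS}SS x : S (S x) = (L ^+ 2)^-1%:C *: Y (Y x).
  by rewrite SS -rE opprB subrKC.
have {Sapprox}Sapprox eps : 0 < eps ->
    exists q : {poly R}, forall x, rn (S x - peval q T x) <= eps * rn x.
  move=> /Sapprox[q hq]; exists (q \Po r) => x; by rewrite peval_comp_poly.
(* S is a norm limit of polynomials in T, and these commute with Y. *)
have SY x : S (Y x) = Y (S x).
  apply/eqP; rewrite -subr_eq0; apply/eqP/rn_eq0/eqP; rewrite eq_le rn_ge0 andbT.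
  rewrite leNgt; apply/negP => d0; set d := rn _ in d0.
  have K0 : 0 < 2 * L * rn x + 1.
    by rewrite ltr_wpDl // !mulr_ge0 ?rn_ge0 // ltW.
  have [q hq] := Sapprox _ (divr_gt0 d0 K0); set eps := d / _ in hq.
  have e0 : 0 < eps by apply: divr_gt0.
  have dE : eps * (2 * L * rn x + 1) = d by rewrite divfK // gt_eqF.
  have : d <= eps * (2 * L * rn x).
    rewrite /d; have -> : S (Y x) - Y (S x) =
        (S (Y x) - peval q T (Y x)) - Y (S x - peval q T x).
      rewrite (linopB _ _ lY) /Y !pevalB !pevalX !pevalC.
      rewrite !(linopB _ _ (peval_linear q lT)) (linopZ _ _ (peval_linear q lT)).
      by rewrite (peval_comm q _ lT); vec_ring.
    apply: (le_trans (rnB _ _)).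
    have h1 := le_trans (hq (Y x)) (ler_wpM2l (ltW e0) (YL x)).
    have h2 := le_trans (YL (S x - peval q T x)) (ler_wpM2l (ltW L0) (hq x)).
    lra.
  lra.
pose P x := S x + L^-1%:C *: Y x.
have AP : A P by apply: (cstar_add hA AS); apply: (cstar_scale hA).
have sP : rself_adjoint P by move=> u v; rewrite !(ripDl, ripDr) ripZl ripZr sS sY.
have lP := cstar_linear hA AP.
have YP x : Y (P x) = L%:C *: S (P x).
  rewrite /P (linopD _ _ lY) (linopZ _ _ lY) (linopD _ _ lS) (linopZ _ _ lS) SS SY.
  by rewrite scalerDr -!scaleCM divff // scale1r addrC expr2 invfM mulVKf.
have [s [As ss sE]] := cstar_positive_sqrt AS sS pS.
have PYP_ge0 : rtau (fun x => P (Y (P x))) = L * rtau (fun x => P (s (s (P x)))).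
  rewrite -rtauZ; last by do 3 apply: (cstar_mul hA) => //.
  by congr rtau; apply/funext => x; rewrite sE YP (linopZ _ _ lP).
have PYP_le0 : rtau (fun x => P (Y (P x))) <= 0.
  have [K K0 PK] := cstar_bound_gt0 AP.
  rewrite leNgt; apply/negP; set d := rtau _ => d0.
  have M0 : 0 < 2 * L * K + L by have := mulr_gt0 L0 K0; lra.
  (* Replacing P by a polynomial Q changes P Y P by at most eps (L K + (K + 1) L); the minimum with
     1 gives |Q| <= K + 1. *)
  pose eps := Num.min 1 (d / (2 * (2 * L * K + L))).
  have e0 : 0 < eps by rewrite lt_min ltr01 /= divr_gt0 // mulr_gt0.
  have e1 : eps <= 1 by rewrite ge_min lexx.
  have ed : eps * (2 * L * K + L) < d.
    apply: (le_lt_trans (y := d / 2)); last by lra.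
    have : eps <= d / (2 * (2 * L * K + L)) by rewrite ge_min lexx orbT.
    by rewrite invfM mulrA ler_pdivlMr.
  have [q hq] := Sapprox _ e0.
  pose p := q + L^-1 *: ('X - rho%:P).
  pose Q := peval p T.
  have PQ x : rn (P x - Q x) <= eps * rn x.
    have -> : P x - Q x = S x - peval q T x.
      by rewrite /P /Q /p pevalD pevalZ -/Y; vec_ring.
    exact: hq.
  have AQ : A Q by apply: cstar_peval.
  have sQ : rself_adjoint Q by apply: peval_self_adjoint.
  have lQ := cstar_linear hA AQ.
  have QYQ : rtau (fun x => Q (Y (Q x))) <= 0.
    have := quadratic_ratio p; rewrite -subr_le0 => h; apply: le_trans h.
    have -> : l ('X * p ^+ 2) - rho * l (p ^+ 2) = l (p * ('X - rho%:P) * p).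
      rewrite -mulNr -lZ -lD -mul_polyC polyCN; congr l; ring.
    by rewrite le_eqVlt; apply/orP; left; apply/eqP; congr rtau; apply/funext => x; rewrite !pevalM.
  have AD : A (fun x => P (Y (P x)) - Q (Y (Q x))).
    by apply: (cstar_sub hA); do 2 apply: (cstar_mul hA) => //.
  have : rtau (fun x => P (Y (P x)) - Q (Y (Q x))) <= eps * (2 * L * K + L).
    apply: rtau_le => //.
      move=> u v; rewrite ripDl ripDr ripNl ripNr.
      by rewrite (sP (Y (P u))) (sY (P u)) (sP u) (sQ (Y (Q u))) (sY (Q u)) (sQ u).
    move=> x; have -> : P (Y (P x)) - Q (Y (Q x)) =
        (P (Y (P x)) - Q (Y (P x))) + Q (Y (P x - Q x)).
      by rewrite (linopB _ _ lY) (linopB _ _ lQ); vec_ring.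
    apply: (le_trans (rnD _ _)).
    have h1 : rn (P (Y (P x)) - Q (Y (P x))) <= eps * (L * (K * rn x)).
      apply: (le_trans (PQ _)); rewrite ler_wpM2l ?(ltW e0) //.
      by apply: (le_trans (YL _)); rewrite ler_wpM2l ?(ltW L0).
    have hQ z : rn (Q z) <= (K + 1) * rn z.
      have := rnB (P z) (P z - Q z); rewrite opprB subrKC => h.
      have := PK z; have := PQ z; have := rn_ge0 z; nra.
    have h2 : rn (Q (Y (P x - Q x))) <= (K + 1) * (L * (eps * rn x)).
      apply: (le_trans (hQ _)); rewrite ler_wpM2l //; first lra.
      by apply: (le_trans (YL _)); rewrite ler_wpM2l ?(ltW L0).
    lra.
  rewrite rtauB; [|by do 2 apply: (cstar_mul hA) => //..].
  by rewrite -/d; lra.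
have AsP : A (fun x => s (P x)) by apply: (cstar_mul hA).
have adjsP : is_adjoint (fun x => s (P x)) (fun x => P (s x)).
  apply: is_adjoint_comp; apply: rself_adjoint_adjoint => //.
  exact: (cstar_linear hA As).
have sP0 x : s (P x) = 0.
  suff /(congr1 (@^~ x)) : (fun x => s (P x)) = 0 by [].
  apply: (ftau AsP); rewrite (adjE adjsP).
  have tge0 := state_pos htau AsP; rewrite (adjE adjsP) in tge0.
  have re0 : rtau (fun x => P (s (s (P x)))) = 0.
    apply/eqP; rewrite eq_le (rtau_adj_comp_ge0 AsP adjsP) andbT.
    by rewrite -(ler_pM2l L0) mulr0 -PYP_ge0.
  move: tge0 re0; rewrite /rtau /comp.
  by case: (tau _) => u v; rewrite lecE /= => /andP[/eqP -> _] ->.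
have SP0 x : S (P x) = 0 by rewrite -sE sP0 (linop0 (cstar_linear hA As)).
have P0 x : P x = 0.
  apply: sqn_eq0; rewrite /sqn sP {1}/P SP0 YP SP0 !scaler0 addr0 rip0r //.
have : rip (Y y) y <= 0.
  (* With P = 0 this leaves Y = - L S, and S is positive. *)
  have -> : Y y = L%:C *: (P y - S y).
    by rewrite /P addrC addKr -scaleCM divff // scale1r.
  by rewrite P0 sub0r ripZl ripNl; have := mulr_ge0 (ltW L0) (pS y); lra.
by rewrite YE ripDl ripNl ripZl subr_le0.
Qed.

End Moments.

End State.

(** * Vectors with finite support and words *)

(* A finitely supported vector of l^2(X; H) is given by a list of pairs (x, y)
   standing for the sum of the elementary tensors of y and delta_x. *)
Section ListVectors.
Variables (R : realType) (H : hilbertType R) (X : choiceType).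
Implicit Types (l r : seq (X * H)) (c : R).

Definition rep l (z : X) : H := \sum_(p <- l | p.1 == z) p.2.

Definition lip l r : R := \sum_(p <- l) \sum_(q <- r | q.1 == p.1) rip p.2 q.2.

Definition lsqn l : R := lip l l.

Definition lscale c l : seq (X * H) := [seq (p.1, c%:C *: p.2) | p <- l].

Lemma lipE l r : lip l r = \sum_(p <- l) rip p.2 (rep r p.1).
Proof. by apply: eq_bigr => p _; rewrite rip_sumr. Qed.

Lemma lip_sym l r : lip l r = lip r l.
Proof.
rewrite /lip (exchange_big_dep xpredT) //=; apply: eq_bigr => q _.
by apply: eq_big => [p|p _]; rewrite 1?eq_sym // rip_sym.
Qed.

Lemma lip_catl l l' r : lip (l ++ l') r = lip l r + lip l' r.
Proof. by rewrite /lip big_cat. Qed.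

Lemma lip_catr l r r' : lip l (r ++ r') = lip l r + lip l r'.
Proof. by rewrite lip_sym lip_catl !(lip_sym l). Qed.

Lemma lip_scalel c l r : lip (lscale c l) r = c * lip l r.
Proof.
rewrite !lipE /lscale big_map mulr_sumr.
by apply: eq_bigr => p _; rewrite ripZl.
Qed.

Lemma lip_scaler c l r : lip l (lscale c r) = c * lip l r.
Proof. by rewrite lip_sym lip_scalel lip_sym. Qed.

(** Expansions of products list their terms in different orders; equality of all sums avoids
    exhibiting a permutation. *)
Lemma lip_eql l l' r : (forall F : X * H -> R, \sum_(p <- l) F p = \sum_(p <- l') F p) ->
  lip l r = lip l' r.
Proof. by move=> e; rewrite !lipE e. Qed.

Lemma lip_cover (s : seq X) l r : uniq s -> {subset [seq p.1 | p <- l] <= s} ->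
  lip l r = \sum_(z <- s) rip (rep l z) (rep r z).
Proof.
move=> us ls; rewrite lipE; under [RHS]eq_bigr => z _ do rewrite rip_suml.
rewrite (exchange_big_dep xpredT) //=; apply: eq_big_seq => p pl.
rewrite (eq_bigl (pred1 p.1)) => [|z]; last by rewrite /= eq_sym.
by rewrite -big_filter filter_pred1_uniq ?big_seq1 // ls // map_f.
Qed.

Lemma lsqn_cover (s : seq X) l : uniq s -> {subset [seq p.1 | p <- l] <= s} ->
  lsqn l = \sum_(z <- s) sqn (rep l z).
Proof. exact: lip_cover. Qed.

Lemma lsqn_undup l : lsqn l = \sum_(z <- undup [seq p.1 | p <- l]) sqn (rep l z).
Proof. by apply: lsqn_cover; [exact: undup_uniq | move=> z; rewrite mem_undup]. Qed.

Lemma lsqn_ge0 l : 0 <= lsqn l.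
Proof. by rewrite lsqn_undup; apply: sumr_ge0 => z _; exact: sqn_ge0. Qed.

Lemma lsqn_ext l r : rep l =1 rep r -> lsqn l = lsqn r.
Proof.
move=> lr; pose s := undup ([seq p.1 | p <- l] ++ [seq p.1 | p <- r]).
have us : uniq s by exact: undup_uniq.
rewrite !(lsqn_cover us); first by apply: eq_bigr => z _; rewrite lr.
  by move=> z zr; rewrite mem_undup mem_cat zr orbT.
by move=> z zl; rewrite mem_undup mem_cat zl.
Qed.

Lemma lsqn_scale c l : lsqn (lscale c l) = c ^+ 2 * lsqn l.
Proof. by rewrite /lsqn lip_scalel lip_scaler mulrA expr2. Qed.

Lemma lsqn_cat l r : lsqn (l ++ r) = lsqn l + 2 * lip l r + lsqn r.
Proof. by rewrite /lsqn lip_catl !lip_catr (lip_sym r l); ring. Qed.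

Lemma lip_CS l r : lip l r ^+ 2 <= lsqn l * lsqn r.
Proof.
apply: discriminant_le; first exact: lsqn_ge0.
move=> u; have := lsqn_ge0 (l ++ lscale u r).
by rewrite lsqn_cat lip_scaler lsqn_scale mulrA.
Qed.

Lemma lip_le_half l r : lip l r <= (lsqn l + lsqn r) / 2.
Proof.
have := lsqn_ge0 (l ++ lscale (-1) r); rewrite lsqn_cat lip_scaler lsqn_scale sqrrN expr1n.
lra.
Qed.

(** Expand |t l - r|^2 / t. A small t keeps the factor of the main part l near 1 at the expense of
    the error r. *)
Lemma lsqn_cat_le (t : R) l r : 0 < t ->
  lsqn (l ++ r) <= (1 + t) * lsqn l + (1 + t^-1) * lsqn r.
Proof.
move=> t0; have := lsqn_ge0 (lscale t l ++ lscale (-1) r).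
rewrite !lsqn_cat !lip_scalel !lip_scaler !lsqn_scale sqrrN expr1n mul1r => h.
have : 0 <= t^-1 * (t ^+ 2 * lsqn l + 2 * (t * (-1 * lip l r)) + lsqn r).
  by rewrite mulr_ge0 // invr_ge0 ltW.
have -> : t^-1 * (t ^+ 2 * lsqn l + 2 * (t * (-1 * lip l r)) + lsqn r) =
  t * lsqn l - 2 * lip l r + t^-1 * lsqn r by field; rewrite gt_eqF.
lra.
Qed.

Lemma lsqn_flatten_le (J : Type) (s : seq J) (F : J -> seq (X * H)) :
  lsqn (flatten [seq F j | j <- s]) <= (size s)%:R * \sum_(j <- s) lsqn (F j).
Proof.
have e r : lip (flatten [seq F j | j <- s]) r = \sum_(j <- s) lip (F j) r.
  by elim: s => [|j s IH]; rewrite ?big_nil ?big_cons /= -?IH -?lip_catl // /lip big_nil.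
rewrite /lsqn e.
apply: (le_trans (y := \sum_(j <- s) \sum_(k <- s) ((lsqn (F j) + lsqn (F k)) / 2))).
  apply: ler_sum => j _; rewrite lip_sym e; apply: ler_sum => k _.
  by rewrite lip_sym lip_le_half.
have sumc (c : R) : \sum_(k <- s) c = (size s)%:R * c.
  elim: (s) => [|k s' IH]; first by rewrite big_nil mul0r.
  by rewrite big_cons IH /= -natr1; ring.
under eq_bigr => j _ do rewrite -mulr_suml big_split /= sumc.
rewrite -mulr_suml big_split /= sumc -mulr_sumr.
set A := \sum_(j <- s) _; lra.
Qed.

Lemma rep_cat l r z : rep (l ++ r) z = rep l z + rep r z.
Proof. by rewrite /rep big_cat. Qed.

Lemma l2sqnorm_rep l : l2sqnorm (rep l) = (lsqn l)%:E.
Proof.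
rewrite lsqn_undup /l2sqnorm; set s := undup _.
have us : uniq s by exact: undup_uniq.
pose f z := ((complex.Re `|rep l z|) ^+ 2)%:E.
rewrite (_ : \esum_(i in [set: X]) f i = \esum_(i in [set` s]) f i); last first.
  rewrite [RHS]esum_mkcond; apply: eq_esum => z _.
  rewrite /=; case: ifPn => //; rewrite notin_setE /= => zs.
  rewrite /f /rep big_seq_cond big_pred0 ?normr0 ?expr0n // => p.
  apply/negP => /andP[pl /eqP pz]; apply: zs; rewrite mem_undup -pz.
  exact: map_f.
rewrite esum_fset //; last by move=> z _; rewrite /f lee_fin sqr_ge0.
rewrite -fsbig_seq // sumEFin; congr (_%:E); apply: eq_bigr => z _.
by rewrite sqnE.
Qed.

End ListVectors.

Section LogConvex.
Variable R : realType.

(** The ratios q (n+1) / q n do not decrease; everything is cross-multiplied because q may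
    vanish. *)
Lemma log_convex_pow (q : nat -> R) (p : nat) : (forall n, 0 <= q n) ->
  (forall n, q n.+1 ^+ 2 <= q n * q n.+2) -> q 1%N ^+ p * q 0%N <= q p * q 0%N ^+ p.
Proof.
move=> q0 lc.
have ratio n : q 1%N * q n <= q n.+1 * q 0%N.
  elim: n => [//|n IH]; have := q0 n.+1; rewrite le0r => /orP[/eqP ->|qp].
    by rewrite mulr0 mulr_ge0.
  rewrite -(ler_pM2r qp) -mulrA -expr2.
  apply: (le_trans (ler_wpM2l (q0 1%N) (lc n))); rewrite mulrA.
  by apply: (le_trans (ler_wpM2r (q0 n.+2) IH)); rewrite -mulrA mulrC [q 0%N * _]mulrC.
elim: p => [|p IH]; first by rewrite !expr0 mul1r mulr1.
rewrite !exprS -mulrA.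
apply: (le_trans (ler_wpM2l (q0 1%N) IH)); rewrite !mulrA.
by rewrite ler_wpM2r ?exprn_ge0.
Qed.

End LogConvex.

Section Words.
Variables (R : realType) (H : hilbertType R) (I : finType).
Local Notation letter := (I * bool)%type.
Implicit Types (w : seq letter) (S : seq (seq letter)).

Definition lstar (x : letter) : letter := (x.1, ~~ x.2).

Definition wstar w : seq letter := rev (map lstar w).

Lemma wstar_cons x w : wstar (x :: w) = wstar w ++ [:: lstar x].
Proof. by rewrite /wstar /= rev_cons cats1. Qed.

Definition letters (b : bool) : seq letter := [seq (i, b) | i <- enum I].

(* The words of the expansion of the alternating product of p factors A and A^*
   whose rightmost factor is A. *)
Fixpoint alt_words (p : nat) : seq (seq letter) :=
  if p is q.+1 then [seq x :: w | x <- letters (odd q), w <- alt_words q]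
  else [:: [::]].

(** The words of the adjoint of the alternating product followed by the product itself: the
    expansion of (A^* A)^p for either parity of p. *)
Definition square_words (p : nat) : seq (seq letter) :=
  [seq u ++ w | u <- map wstar (alt_words p), w <- alt_words p].

Definition wact (T : Type) (f : letter -> T -> T) w : T -> T :=
  foldr (fun x g => f x \o g) id w.

Lemma wact_cat (T : Type) (f : letter -> T -> T) u w (t : T) :
  wact f (u ++ w) t = wact f u (wact f w t).
Proof. by elim: u => //= x u ->. Qed.

Variable a : letter -> H -> H.
Hypothesis la : forall x, linear (a x).
Hypothesis adj_a : forall x, is_adjoint (a x) (a (lstar x)).

Lemma wact_linear w : linear (wact a w).
Proof. by elim: w => [|x w IH] k u v //=; rewrite IH la. Qed.

Lemma rip_wact w u v : rip (wact a w u) v = rip u (wact a (wstar w) v).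
Proof.
elim: w v => //= x w IH v; rewrite (adjoint_rip (adj_a x)) IH.
by rewrite wstar_cons wact_cat.
Qed.

Section Action.
Variables (X : choiceType) (sg : letter -> X -> X).
Hypothesis sgK : forall x, cancel (sg x) (sg (lstar x)).
Implicit Types (l r : seq (X * H)).

Definition wop S l : seq (X * H) :=
  [seq (wact sg w q.1, wact a w q.2) | w <- S, q <- l].

(** [step false] is the operator A, the sum of the a_i combined with the moves [sg], and [step true]
    is its adjoint. *)
Definition step b l := wop [seq [:: x] | x <- letters b] l.

Lemma big_wop (V : nmodType) S l (F : X * H -> V) :
  \sum_(p <- wop S l) F p =
  \sum_(w <- S) \sum_(q <- l) F (wact sg w q.1, wact a w q.2).
Proof. by rewrite /wop big_allpairs_dep. Qed.

Lemma big_wop_comp (V : nmodType) S S' l (F : X * H -> V) :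
  \sum_(p <- wop S (wop S' l)) F p =
  \sum_(p <- wop [seq u ++ w | u <- S, w <- S'] l) F p.
Proof.
rewrite !big_wop big_allpairs_dep; apply: eq_bigr => u _; rewrite big_wop.
by apply: eq_bigr => w _; apply: eq_bigr => q _; rewrite !wact_cat.
Qed.

Lemma wact_sg_eq w x y : (wact sg w x == y) = (x == wact sg (wstar w) y).
Proof.
elim: w y => //= z w IH y; rewrite wstar_cons wact_cat /= -IH.
apply/eqP/eqP => [<-|->]; first by rewrite sgK.
by have := sgK (lstar z) y; rewrite /lstar /= negbK; case: z.
Qed.

Lemma wop_adj S l r : lip (wop S l) r = lip l (wop (map wstar S) r).
Proof.
rewrite [RHS]lip_sym /lip !big_wop big_map; apply: eq_bigr => w _.
rewrite (exchange_big_dep xpredT) //=; apply: eq_bigr => q _.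
apply: eq_big => [p|p _]; first by rewrite eq_sym wact_sg_eq.
by rewrite rip_wact rip_sym.
Qed.

Lemma step_adj b l r : lip (step b l) r = lip l (step (~~ b) r).
Proof.
rewrite /step wop_adj; congr (lip _ (wop _ _)).
by rewrite /letters -!map_comp; apply: eq_map => i.
Qed.

Definition alt p l := wop (alt_words p) l.

Lemma lip_altS p l r : lip (alt p.+1 l) r = lip (step (odd p) (alt p l)) r.
Proof.
apply: lip_eql => F; rewrite /step /alt /= big_wop_comp.
by rewrite allpairs_mapl.
Qed.

Lemma lsqn_altS p l : lsqn (alt p.+1 l) = lsqn (step (odd p) (alt p l)).
Proof. by rewrite /lsqn lip_altS lip_sym lip_altS. Qed.

Lemma lip_alt_alt p l r : lip (alt p l) (alt p r) = lip (wop (square_words p) l) r.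
Proof.
by rewrite lip_sym /alt wop_adj lip_sym; apply: lip_eql => F; rewrite big_wop_comp.
Qed.

(** Because the factors alternate, moving the outermost one across the inner product turns |alt
    (p+1) l|^2 into <alt p l, alt (p+2) l>. *)
Lemma lsqn_alt_log_convex p l :
  lsqn (alt p.+1 l) ^+ 2 <= lsqn (alt p l) * lsqn (alt p.+2 l).
Proof.
rewrite {1}/lsqn lip_altS step_adj lip_sym -[~~ odd p]/(odd p.+1) -lip_altS lip_sym.
exact: lip_CS.
Qed.

Lemma wop1 l : wop [:: [::]] l = l.
Proof. by rewrite /wop /= cats0 map_id_in // => -[]. Qed.

Lemma lsqn_step_pow p l : lsqn (step false l) ^+ p * lsqn l <= lsqn (alt p l) * lsqn l ^+ p.
Proof.
have := log_convex_pow p (fun n => lsqn_ge0 (alt n l)) (fun n => lsqn_alt_log_convex n l).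
by rewrite lsqn_altS /alt /= wop1.
Qed.

(** C is an invariant class, later the vectors with zero sum. The bound for the adjoint steps is
    obtained by duality inside C. *)
Lemma lsqn_alt_le (C : seq (X * H) -> Prop) (K : R) p l : 0 <= K ->
  (forall S r, C r -> C (wop S r)) ->
  (forall r, C r -> lsqn (step false r) <= K * lsqn r) ->
  C l -> lsqn (alt p l) <= K ^+ p * lsqn l.
Proof.
move=> K0 CS CK Cl.
have CKb b r : C r -> lsqn (step b r) <= K * lsqn r.
  case: b => Cr; last exact: CK.
  set r' := step true r; have r'0 := lsqn_ge0 r'.
  have h : lsqn r' ^+ 2 <= K * lsqn r' * lsqn r.
    rewrite {1}/lsqn {1}/r' step_adj lip_sym.
    apply: (le_trans (lip_CS _ _)); rewrite ler_wpM2r ?lsqn_ge0 //.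
    by apply: CK; apply: CS.
  move: r'0; rewrite le0r => /orP[/eqP ->|r'p]; first by rewrite mulr_ge0 ?lsqn_ge0.
  by rewrite -(ler_pM2r r'p) -expr2 mulrAC.
elim: p => [|p IH]; first by rewrite /alt /= wop1 expr0 mul1r.
rewrite lsqn_altS exprS -mulrA.
apply: (le_trans (CKb _ _ _)); first exact: CS.
by rewrite ler_wpM2l.
Qed.

(* The coefficient at delta_x of |A|^(2p) applied to y (x) delta_x. *)
Definition diag_coef p (x : X) (y : H) : H :=
  \sum_(w <- square_words p | wact sg w x == x) wact a w y.

Lemma lip_alt_delta p x y z :
  lip (alt p [:: (x, y)]) (alt p [:: (x, z)]) = rip (diag_coef p x y) z.
Proof.
rewrite lip_alt_alt /lip big_wop /diag_coef rip_suml [RHS]big_mkcond /=.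
apply: eq_bigr => w _; rewrite big_seq1 /= big_cons big_nil /= eq_sym.
by case: ifP => _; rewrite ?addr0.
Qed.

End Action.
End Words.

(** * Localization along a tree *)

Section TentWeights.
Variables (R : realType) (m : nat).

(* The two leading zeros make the differences of the tent vanish at [0], where
   [ht x + r - z] below is truncated. *)
Definition tent (j : nat) : R := (minn j.-1 (m.*2.+1 - j))%:R.

Lemma tent0 : tent 0 = 0. Proof. by rewrite /tent min0n. Qed.
Lemma tent1 : tent 1 = 0. Proof. by rewrite /tent min0n. Qed.

Lemma tent_out j : (m.*2 < j)%N -> tent j = 0.
Proof. by move=> h; rewrite /tent (eqP h) minn0. Qed.

Definition tent_mass : R := \sum_(j < m.*2.+2) tent j ^+ 2.
Definition tent_up : R := \sum_(j < m.*2.+2) (tent j.+1 - tent j) ^+ 2.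
Definition tent_down : R := \sum_(j < m.*2.+2) (tent j.-1 - tent j) ^+ 2.

Lemma tent_step j : (tent j.+1 - tent j) ^+ 2 <= 1.
Proof.
suff h : -1 <= tent j.+1 - tent j <= 1 by case/andP: h => h1 h2; nra.
rewrite /tent /=.
have /orP[/eqP ->|/orP[/eqP ->|/eqP ->]] :
  (minn j (m.*2.+1 - j.+1) == minn j.-1 (m.*2.+1 - j)) ||
  ((minn j (m.*2.+1 - j.+1) == (minn j.-1 (m.*2.+1 - j)).+1) ||
   (minn j.-1 (m.*2.+1 - j) == (minn j (m.*2.+1 - j.+1)).+1)) by lia.
- by rewrite subrr; lra.
- by rewrite -natr1; lra.
- by rewrite -natr1; lra.
Qed.

Lemma tent_up_le : tent_up <= m.*2%:R.
Proof.
rewrite /tent_up big_ord_recl big_ord_recr /= tent0 tent1 subrr expr0n /= add0r.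
rewrite (_ : bump 0 m.*2 = m.*2.+1) // !tent_out // subrr expr0n addr0 /=.
apply: (le_trans (y := \sum_(i < m.*2) 1)); last by rewrite sumr_const card_ord.
by apply: ler_sum => i _; rewrite tent_step.
Qed.

Lemma tent_down_le : tent_down <= m.*2%:R.
Proof.
rewrite /tent_down !big_ord_recl /= tent0 tent1 subrr expr0n /= !add0r.
apply: (le_trans (y := \sum_(i < m.*2) 1)); last by rewrite sumr_const card_ord.
by apply: ler_sum => i _; rewrite -sqrrN opprB tent_step.
Qed.

(** The tent climbs from 0 to m and descends again, so its mass is a sum of squares up to m plus one
    up to m - 1. The subtracted term in [sq] is the quadratic part of the first sum. *)
Lemma tent_mass_ge : (0 < m)%N -> 2 * m%:R ^+ 3 / 3 <= tent_mass.
Proof.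
move=> m0.
have sq n : (n%:R ^+ 3 / 3 <= \sum_(j < n.+1) (j%:R : R) ^+ 2 - n%:R ^+ 2 / 2)%R.
  elim: n => [|n IH]; first by rewrite big_ord1 !expr0n /=; lra.
  rewrite big_ord_recr /= -natr1; have : 0 <= n%:R :> R by [].
  move: IH; set s := \sum_(j < _) _; nra.
have -> : tent_mass = \sum_(j < m.+1) (j%:R : R) ^+ 2 + \sum_(j < m) (j%:R : R) ^+ 2.
  rewrite /tent_mass big_ord_recl tent0 expr0n add0r /=.
  rewrite -[LHS](big_mkord xpredT (fun j => tent j.+1 ^+ 2)).
  rewrite (@big_cat_nat _ _ _ m.+1) //=; last by rewrite ltnS -addnn leq_addr.
  congr (_ + _); first rewrite big_mkord; first apply: eq_bigr => j _.
    by congr (_%:R ^+ 2); have := ltn_ord j; lia.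
  rewrite -[m.+1 in X in X = _]add0n big_addn big_mkord.
  rewrite (reindex_inj rev_ord_inj) /= (_ : (m.*2.+1 - m.+1 = m)%N); last lia.
  by apply: eq_bigr => j _; congr (_%:R ^+ 2); have := ltn_ord j; lia.
have := sq m; rewrite big_ord_recr /=; set s := \sum_(j < _) _ => h; lra.
Qed.

(** As z grows, n - z takes each value from n down to 1 once and then stays at 0, where f
    vanishes. *)
Lemma sum_truncated_shift (f : nat -> R) (n N k : nat) : (n <= N)%N -> (k <= n.+1)%N ->
  f 0%N = 0 -> (forall j, (k <= j)%N -> f j = 0) ->
  \sum_(z < N) f (n - z)%N = \sum_(j < k) f j.
Proof.
move=> nN kn f0 fk.
rewrite -(big_mkord xpredT (fun z => f (n - z)%N)) (@big_cat_nat _ _ _ n) //=.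
rewrite [X in _ + X]big_nat_cond [X in _ + X]big1 ?addr0; last first.
  by move=> z /andP[/andP[/eqP -> _] _].
rewrite big_nat_rev /= add0n.
have -> : \sum_(0 <= i < n) f (n - (n - i.+1))%N = \sum_(0 <= i < n) f i.+1.
  by apply: eq_big_nat => i /andP[_ ni]; rewrite subKn.
have -> : \sum_(0 <= i < n) f i.+1 = \sum_(j < n.+1) f j.
  by rewrite big_ord_recl f0 add0r big_mkord.
rewrite -(big_mkord xpredT f) (@big_cat_nat _ _ _ k) //= big_mkord.
rewrite [X in _ + X]big_nat_cond [X in _ + X]big1 ?addr0 //.
by move=> z /andP[/andP[/fk]].
Qed.

End TentWeights.

Section WeightedSteps.
Variables (R : realType) (H : hilbertType R) (I : finType) (X : choiceType).
Variables (a : I * bool -> H -> H) (sg : I * bool -> X -> X).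
Hypothesis la : forall x, linear (a x).
Hypothesis adj_a : forall x, is_adjoint (a x) (a (lstar x)).
Hypothesis sgK : forall x, cancel (sg x) (sg (lstar x)).
Implicit Types (l : seq (X * H)) (u : I -> X -> R) (e : X -> R).

Local Notation stepA := (step a sg false).

Definition vscale e l : seq (X * H) := [seq (q.1, (e q.1)%:C *: q.2) | q <- l].

(** A Schur multiplier of A: the entry along the edge from x with label i is weighted by [u i x]. *)
Definition wstep u l : seq (X * H) :=
  [seq (sg (i, false) q.1, (u i q.1)%:C *: a (i, false) q.2) | i <- enum I, q <- l].

Lemma big_wstep (V : nmodType) u l (P : pred (X * H)) (F : X * H -> V) :
  \sum_(p <- wstep u l | P p) F p = \sum_(i <- enum I)
    \sum_(q <- l | P (sg (i, false) q.1, (u i q.1)%:C *: a (i, false) q.2))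
       F (sg (i, false) q.1, (u i q.1)%:C *: a (i, false) q.2).
Proof.
rewrite big_mkcond big_allpairs_dep; apply: eq_bigr => i _.
by rewrite [RHS]big_mkcond.
Qed.

Lemma big_step (V : nmodType) l (P : pred (X * H)) (F : X * H -> V) :
  \sum_(p <- stepA l | P p) F p = \sum_(i <- enum I)
    \sum_(q <- l | P (sg (i, false) q.1, a (i, false) q.2))
       F (sg (i, false) q.1, a (i, false) q.2).
Proof.
rewrite big_mkcond /step big_wop /letters !big_map; apply: eq_bigr => i _.
by rewrite [RHS]big_mkcond.
Qed.

Lemma rep_wstep u l z : rep (wstep u l) z = \sum_(i <- enum I)
  \sum_(q <- l | sg (i, false) q.1 == z) (u i q.1)%:C *: a (i, false) q.2.
Proof. exact: big_wstep. Qed.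

Lemma rep_step l z : rep (stepA l) z = \sum_(i <- enum I)
  \sum_(q <- l | sg (i, false) q.1 == z) a (i, false) q.2.
Proof. exact: big_step. Qed.

Lemma rep_vscale e l z : rep (vscale e l) z = (e z)%:C *: rep l z.
Proof.
by rewrite /rep /vscale big_map scaler_sumr /=; apply: eq_bigr => p /eqP <-.
Qed.

Lemma lsqn_vscale_sum (K : Type) (s : seq K) (phi : K -> X -> R) (c : R) l :
  (forall q, q \in [seq p.1 | p <- l] -> \sum_(k <- s) phi k q ^+ 2 = c) ->
  \sum_(k <- s) lsqn (vscale (phi k) l) = c * lsqn l.
Proof.
move=> phic; rewrite /lsqn /lip /vscale.
under eq_bigr => k _ do rewrite big_map.
rewrite exchange_big mulr_sumr; apply: eq_big_seq => p pl /=.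
under eq_bigr => k _ do rewrite big_map /=.
rewrite exchange_big /= mulr_sumr; apply: eq_bigr => q /eqP qp.
under eq_bigr => k _ do rewrite ripZl ripZr qp mulrA -expr2.
by rewrite -mulr_suml phic // map_f.
Qed.

Lemma lsqn_vscale_sign e l : (forall x, e x ^+ 2 = 1) -> lsqn (vscale e l) = lsqn l.
Proof.
move=> e1; have := @lsqn_vscale_sum unit [:: tt] (fun _ => e) 1 l.
by rewrite big_seq1 mul1r; apply=> q _; rewrite big_seq1.
Qed.

Variable M2 : R.
Hypothesis M20 : 0 <= M2.
Hypothesis stepM : forall l, lsqn (stepA l) <= M2 * lsqn l.

Lemma lsqn_wstep_sign (e1 e2 : X -> R) l :
  (forall x, e1 x ^+ 2 = 1) -> (forall x, e2 x ^+ 2 = 1) ->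
  lsqn (wstep (fun i x => e1 (sg (i, false) x) * e2 x) l) <= M2 * lsqn l.
Proof.
move=> h1 h2; rewrite -(lsqn_vscale_sign l h2).
apply: le_trans (stepM _); rewrite -(lsqn_vscale_sign (stepA _) h1).
rewrite le_eqVlt; apply/orP; left; apply/eqP; apply: lsqn_ext => z.
rewrite rep_wstep rep_vscale rep_step scaler_sumr; apply: eq_bigr => i _.
rewrite scaler_sumr big_map; apply: eq_bigr => q /eqP <- /=.
by rewrite linopZ // -scaleCM.
Qed.

(* Conjugating A by diagonal signs does not change its norm. *)
Lemma lsqn_wstep_average (E : seq ((X -> R) * (X -> R))) u l : (0 < size E)%N ->
  (forall i, (i < size E)%N -> let e := nth (fun _ => 0, fun _ => 0) E i in
     forall x, e.1 x ^+ 2 = 1 /\ e.2 x ^+ 2 = 1) ->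
  (forall i x, (size E)%:R * u i x = \sum_(e <- E) e.1 (sg (i, false) x) * e.2 x) ->
  lsqn (wstep u l) <= M2 * lsqn l.
Proof.
move=> E0 signs uE; set n := size E; have n0 : 0 < n%:R :> R by rewrite ltr0n.
pose F (e : (X -> R) * (X -> R)) := wstep (fun i x => e.1 (sg (i, false) x) * e.2 x) l.
have FE : lsqn (flatten [seq F g | g <- E]) = n%:R ^+ 2 * lsqn (wstep u l).
  rewrite -lsqn_scale; apply: lsqn_ext => z.
  have -> : rep (flatten [seq F g | g <- E]) z = \sum_(g <- E) rep (F g) z.
    rewrite /rep; elim: (E) => [|g E' IH]; first by rewrite !big_nil.
    by rewrite /= big_cat big_cons IH.
  rewrite -[lscale _ _]/(vscale (fun=> n%:R) (wstep u l)) rep_vscale rep_wstep scaler_sumr.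
  under eq_bigr => g _ do rewrite rep_wstep.
  rewrite exchange_big; apply: eq_bigr => i _ /=.
  rewrite exchange_big scaler_sumr; apply: eq_bigr => q _ /=.
  by rewrite -scaleCM uE rmorph_sum scaler_suml.
have n20 : 0 < n%:R ^+ 2 :> R by rewrite exprn_gt0.
rewrite -(ler_pM2l n20) -FE; apply: (le_trans (lsqn_flatten_le _ _)).
rewrite -/n expr2 -mulrA ler_wpM2l ?(ltW n0) //.
apply: (le_trans (y := \sum_(g <- E) M2 * lsqn l)); last first.
  have sumc (c : R) (s : seq ((X -> R) * (X -> R))) : \sum_(k <- s) c = (size s)%:R * c.
    elim: s => [|k s' IH]; first by rewrite big_nil mul0r.
    by rewrite big_cons IH /= -natr1; ring.
  by rewrite sumc.
rewrite !(big_nth (fun _ => 0, fun _ => 0)) !big_mkord; apply: ler_sum => i _.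
by apply: lsqn_wstep_sign => x; have [] := signs i (ltn_ord i) x.
Qed.

Variable ht : X -> nat.
Hypothesis ht_step : forall i x, let x' := sg (i, false) x in
  [\/ x' = x, ht x' = (ht x).+1 | ht x = (ht x').+1].

Definition is_up (i : I) (x : X) : R := (ht (sg (i, false) x) == (ht x).+1)%:R.
Definition is_down (i : I) (x : X) : R := (ht x == (ht (sg (i, false) x)).+1)%:R.

Let s (n : nat) : R := (-1) ^+ n./2.
Let t (n : nat) : R := (-1) ^+ n.

Let s_sqr n : s n ^+ 2 = 1. Proof. by rewrite /s sqrr_sign. Qed.
Let t_sqr n : t n ^+ 2 = 1. Proof. by rewrite /t sqrr_sign. Qed.
Let tS n : t n.+1 = - t n. Proof. by rewrite /t exprS mulN1r. Qed.
Let sS n : s n.+1 * s n = t n.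
Proof.
by rewrite /s -exprD -[n.+1./2]/(uphalf n) uphalf_half -addnA addnn odd_double_half.
Qed.

(** Four conjugations by signs whose average selects a direction. The first two add up to 2 on edges
    that change the height and cancel on loops. By [sS], the last two add up to 2b on rising edges,
    -2b on falling ones and 0 on loops. So b = 1 gives 4 times [is_up] and b = -1 gives 4 times
    [is_down]. *)
Let signs (b : R) : seq ((X -> R) * (X -> R)) :=
  [:: (fun=> 1, fun=> 1); (fun x => - t (ht x), fun x => t (ht x));
      (fun x => b * s (ht x), fun x => s (ht x) * t (ht x));
      (fun x => - b * s (ht x).+1, fun x => s (ht x).+1 * t (ht x))].

Let signsP b : b ^+ 2 = 1 ->
  forall i, (i < size (signs b))%N -> let e := nth (fun _ => 0, fun _ => 0) (signs b) i in
     forall x, e.1 x ^+ 2 = 1 /\ e.2 x ^+ 2 = 1.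
Proof.
move=> b1 [|[|[|[|i]]]] //= _ x; rewrite ?expr1n ?exprMn ?sqrrN ?s_sqr ?t_sqr ?b1 ?mulr1 //.
Qed.

Lemma lsqn_wstep_up l : lsqn (wstep is_up l) <= M2 * lsqn l.
Proof.
apply: (@lsqn_wstep_average (signs 1)) => //; first by apply: signsP; rewrite expr1n.
move=> i x; rewrite /signs !big_cons big_nil /= /is_up.
case: (ht_step i x) => [->|->|->]; set n := ht _.
- rewrite (_ : n == n.+1 = false); last by apply/eqP; lia.
  transitivity (1 - t n ^+ 2 + t n * (s n ^+ 2 - s n.+1 ^+ 2)); last by ring.
  by rewrite t_sqr !s_sqr /=; ring.
- rewrite eqxx tS; transitivity (1 + t n ^+ 2 + s n.+1 * s n * t n
    - s n.+2 * s n.+1 * t n); last by ring.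
  by rewrite !sS tS mulNr -expr2 t_sqr /=; ring.
- rewrite (_ : n == n.+2 = false); last by apply/eqP; lia.
  rewrite tS; transitivity (1 + t n ^+ 2 - s n.+1 * s n * t n
    + s n.+2 * s n.+1 * t n); last by ring.
  by rewrite !sS tS mulNr -expr2 t_sqr /=; ring.
Qed.

Lemma lsqn_wstep_down l : lsqn (wstep is_down l) <= M2 * lsqn l.
Proof.
apply: (@lsqn_wstep_average (signs (-1))) => //; first by apply: signsP; rewrite sqrrN expr1n.
move=> i x; rewrite /signs !big_cons big_nil /= /is_down.
case: (ht_step i x) => [->|->|->]; set n := ht _.
- rewrite (_ : n == n.+1 = false); last by apply/eqP; lia.
  transitivity (1 - t n ^+ 2 - t n * (s n ^+ 2 - s n.+1 ^+ 2)); last by ring.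
  by rewrite t_sqr !s_sqr /=; ring.
- rewrite (_ : n == n.+2 = false); last by apply/eqP; lia.
  rewrite tS; transitivity (1 + t n ^+ 2 - s n.+1 * s n * t n
    + s n.+2 * s n.+1 * t n); last by ring.
  by rewrite !sS tS mulNr -expr2 t_sqr /=; ring.
- rewrite eqxx tS; transitivity (1 + t n ^+ 2 + s n.+1 * s n * t n
    - s n.+2 * s n.+1 * t n); last by ring.
  by rewrite !sS tS mulNr -expr2 t_sqr /=; ring.
Qed.

Variables (V : choiceType) (anc : nat -> X -> V).
Hypothesis anc_up : forall i x, let x' := sg (i, false) x in
  ht x' = (ht x).+1 -> forall j, anc j.+1 x' = anc j x.
Hypothesis anc_down : forall i x, let x' := sg (i, false) x in
  ht x = (ht x').+1 -> forall j, anc j.+1 x = anc j x'.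

Variables (m : nat) (K : R).
Hypothesis local : forall v l,
  (forall q, q \in [seq p.1 | p <- l] -> exists2 j, (j <= m.*2)%N & anc j q = v) ->
  lsqn (stepA l) <= K * lsqn l.

(** A cutoff leaves entries with vector 0 whose points lie outside the ball; they are dropped before
    [local] is applied. *)
Let lsqn_nz l : lsqn [seq q <- l | q.2 != 0] = lsqn l.
Proof.
apply: lsqn_ext => z; rewrite /rep big_filter_cond big_mkcond [RHS]big_mkcond.
by apply: eq_bigr => q _; case: eqP => [->|] //=; case: ifP.
Qed.

Let lsqn_step_nz l : lsqn (stepA [seq q <- l | q.2 != 0]) = lsqn (stepA l).
Proof.
apply: lsqn_ext => z; rewrite !rep_step; apply: eq_bigr => i _.
rewrite big_filter_cond big_mkcond [RHS]big_mkcond.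
by apply: eq_bigr => q _; case: eqP => [->|] //=; rewrite linop0 //; case: ifP.
Qed.

Let wstep_comm e l : lsqn (vscale e (stepA l)) =
  lsqn (stepA (vscale e l) ++ wstep (fun i x => e (sg (i, false) x) - e x) l).
Proof.
apply: lsqn_ext => z; rewrite rep_cat rep_wstep rep_vscale !rep_step scaler_sumr.
rewrite -big_split; apply: eq_bigr => i _ /=; rewrite big_map -big_split scaler_sumr.
apply: eq_bigr => q /eqP <- /=; rewrite (linopZ _ _ (la (i, false))); vec_ring.
Qed.

Let wstep_mul u e l : lsqn (wstep (fun i x => u i x * e x) l) = lsqn (wstep u (vscale e l)).
Proof.
apply: lsqn_ext => z; rewrite !rep_wstep; apply: eq_bigr => i _; rewrite big_map.
by apply: eq_bigr => q _ /=; rewrite linopZ // scaleCM.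
Qed.

Let wstep_add u u' l : lsqn (wstep (fun i x => u i x + u' i x) l) =
  lsqn (wstep u l ++ wstep u' l).
Proof.
apply: lsqn_ext => z; rewrite rep_cat !rep_wstep -big_split; apply: eq_bigr => i _ /=.
by rewrite -big_split; apply: eq_bigr => q _ /=; rewrite scaleCD.
Qed.

(* The cutoffs [phi] follow the rays [anc] towards the root, so that A almost
   commutes with them; [phi k l] is supported in a ball. *)
Lemma localization (d : R) l : 0 < d ->
  tent_mass R m * lsqn (stepA l) <=
  ((1 + d) * (K * tent_mass R m) + (1 + d^-1) * (M2 * (4 * m.*2%:R))) * lsqn l.
Proof.
move=> d0; pose r := m.*2.+2.
pose keys := [seq p.1 | p <- l] ++ [seq p.1 | p <- stepA l].
pose N := \max_(x <- keys) (ht x + r).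
pose Vs := undup [seq anc j x | x <- keys, j <- iota 0 N.+1].
pose ks := [seq (z, v) | z <- iota 0 N, v <- Vs].
(* The key (z, v) stands for the vertex v at height z - r; the shift by r keeps z natural even when
   j exceeds the height of x. Moving x one step away from the root raises j by one and keeps the
   ancestor v, so the cutoff just moves along its profile f. *)
pose wt (f : nat -> R) (k : nat * V) x : R :=
  let j := (ht x + r - k.1)%N in (anc j x == k.2)%:R * f j.
have wt_sum (f : nat -> R) x : x \in keys -> f 0%N = 0 ->
    (forall j, (r <= j)%N -> f j = 0) ->
    \sum_(k <- ks) wt f k x ^+ 2 = \sum_(j < r) f j ^+ 2.
  move=> xk f0 fr; have xN : (ht x + r <= N)%N by exact: leq_bigmax_seq.
  rewrite big_allpairs_dep /= -[RHS](@sum_truncated_shift _ (fun j => f j ^+ 2) (ht x + r) N) //; last first.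
  - by move=> j /fr ->; rewrite expr0n.
  - by rewrite f0 expr0n.
  - by rewrite leqW // leq_addl.
  rewrite -(big_mkord xpredT (fun z => f (ht x + r - z)%N ^+ 2)) /index_iota subn0.
  apply: eq_bigr => z _; rewrite /wt /=; set j := (_ - _)%N.
  rewrite (bigD1_seq (anc j x)) /= ?undup_uniq //; last first.
    rewrite mem_undup; apply: allpairs_f => //.
    by rewrite mem_iota /= ltnS (leq_trans (leq_subr _ _)).
  rewrite eqxx mul1r big1 ?addr0 // => v; rewrite eq_sym => /negbTE ->.
  by rewrite mul0r expr0n.
have keysl x : x \in [seq p.1 | p <- l] -> x \in keys by rewrite mem_cat => ->.
have keyss x : x \in [seq p.1 | p <- stepA l] -> x \in keys.
  by rewrite mem_cat orbC => ->.
pose phi := wt (tent R m).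
pose up := wt (fun j => tent R m j.+1 - tent R m j).
pose dn := wt (fun j => tent R m j.-1 - tent R m j).
have tent_r j : (r <= j)%N -> tent R m j = 0 by move=> rj; apply: tent_out; lia.
have phiE k i x : phi k (sg (i, false) x) - phi k x =
    is_up i x * up k x + is_down i x * dn k x.
  rewrite /is_up /is_down; case: (ht_step i x) => [xE|hE|hE].
  - rewrite xE (_ : ht x == (ht x).+1 = false); last by apply/eqP; lia.
    by rewrite subrr !mul0r addr0.
  - rewrite hE eqxx (_ : ht x == _ = false); last by apply/eqP; lia.
    rewrite mul0r addr0 mul1r /phi /up /wt hE.
    have [zn|nz] := leqP k.1 (ht x + r).
      by rewrite addSn subSn // (anc_up hE) mulrBr.
    have -> : ((ht x).+1 + r - k.1)%N = 0%N by lia.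
    have -> : (ht x + r - k.1)%N = 0%N by lia.
    by rewrite tent0 tent1 subrr !mulr0 subrr.
  - rewrite -hE eqxx (_ : ht _ == (ht x).+1 = false); last by apply/eqP; lia.
    rewrite mul0r add0r mul1r /phi /dn /wt; set x' := sg _ _ in hE *.
    have [zn|nz] := leqP k.1 (ht x' + r).
      have -> : (ht x + r - k.1)%N = (ht x' + r - k.1).+1 by lia.
      by rewrite (anc_down hE) mulrBr.
    have -> : (ht x + r - k.1)%N = 0%N by lia.
    have -> : (ht x' + r - k.1)%N = 0%N by lia.
    by rewrite /= tent0 subrr !mulr0 subrr.
rewrite -(lsqn_vscale_sum (s := ks) (phi := phi)); last first.
  by move=> x /keyss xk; apply: wt_sum; rewrite ?tent0.
rewrite mulrDl -!mulrA -(lsqn_vscale_sum (s := ks) (phi := phi) (l := l)); last first.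
  by move=> x /keysl xk; apply: wt_sum; rewrite ?tent0.
have hup : \sum_(k <- ks) lsqn (vscale (up k) l) <= m.*2%:R * lsqn l.
  rewrite (lsqn_vscale_sum (c := tent_up R m)) ?ler_wpM2r ?lsqn_ge0 ?tent_up_le //.
  move=> x /keysl xk; apply: wt_sum => //; first by rewrite tent0 tent1 subrr.
  by move=> j rj; rewrite !tent_r ?subrr // leqW.
have hdn : \sum_(k <- ks) lsqn (vscale (dn k) l) <= m.*2%:R * lsqn l.
  rewrite (lsqn_vscale_sum (c := tent_down R m)) ?ler_wpM2r ?lsqn_ge0 ?tent_down_le //.
  move=> x /keysl xk; apply: wt_sum => //; first by rewrite tent0 subrr.
  by move=> j rj; rewrite [tent R m j]tent_r // tent_out ?subrr //; rewrite /r in rj; lia.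
(* Each cutoff splits into A applied to the localized vector and a commutator. The commutator has a
   rising and a falling part; separating them gives the factors 2, hence the 4 in the statement. *)
apply: (le_trans (y := \sum_(k <- ks) ((1 + d) * (K * lsqn (vscale (phi k) l)) +
    (1 + d^-1) * (M2 * (2 * lsqn (vscale (up k) l)) + M2 * (2 * lsqn (vscale (dn k) l)))))).
  apply: ler_sum => k _; rewrite wstep_comm.
  apply: (le_trans (lsqn_cat_le _ _ d0)); apply: lerD.
    rewrite ler_wpM2l ?addr_ge0 ?(ltW d0) //.
    rewrite -lsqn_step_nz -[lsqn (vscale _ l)]lsqn_nz; apply: (local (v := k.2)).
    move=> x /mapP[q]; rewrite mem_filter => /andP[q0 /mapP[p pl qE]] xq.
    move: q0; rewrite xq qE /= /phi /wt => q0; exists (ht p.1 + r - k.1)%N.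
      rewrite leqNgt; apply: contra q0 => /tent_out ->.
      by rewrite mulr0 scale0r.
    by apply/eqP; apply: contraR q0 => /negbTE ->; rewrite mul0r scale0r.
  rewrite ler_wpM2l ?addr_ge0 ?invr_ge0 ?(ltW d0) //.
  have -> : wstep (fun i x => phi k (sg (i, false) x) - phi k x) l =
      wstep (fun i x => is_up i x * up k x + is_down i x * dn k x) l.
    by congr (wstep _ _); apply/funext => i; apply/funext => x; exact: phiE.
  rewrite wstep_add; apply: (le_trans (lsqn_cat_le _ _ ltr01)); rewrite invr1.
  rewrite !wstep_mul !(mulrCA M2); apply: lerD; rewrite ler_wpM2l ?addr_ge0 //.
    exact: lsqn_wstep_up.
  exact: lsqn_wstep_down.
rewrite big_split /= -!mulr_sumr lerD // ler_wpM2l ?addr_ge0 ?invr_ge0 ?(ltW d0) //.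
rewrite big_split /= -!mulr_sumr.
have := ler_wpM2l M20 hup; have := ler_wpM2l M20 hdn; lra.
Qed.

End WeightedSteps.

(** * Actions of the free group *)

Section LocalPower.
Variables (R : realType) (H : hilbertType R) (I : finType) (X : choiceType).
Variables (a : I * bool -> H -> H) (sg : I * bool -> X -> X).
Hypothesis la : forall x, linear (a x).
Hypothesis adj_a : forall x, is_adjoint (a x) (a (lstar x)).
Hypothesis sgK : forall x, cancel (sg x) (sg (lstar x)).
Implicit Types (l : seq (X * H)).

Lemma rep_wop S l z : rep (wop a sg S l) z =
  \sum_(w <- S) \sum_(q <- l | wact sg w q.1 == z) wact a w q.2.
Proof.
rewrite /rep big_mkcond big_wop; apply: eq_bigr => w _.
by rewrite [RHS]big_mkcond.
Qed.

(** Splitting l over its points costs a factor [size D] by Cauchy-Schwarz, but only for the p-th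
    power of the operator; [lsqn_step_pow] then takes the p-th root. *)
Lemma lsqn_step_local (p : nat) (D : seq X) (L K M2 : R) l : (0 < p)%N ->
  0 <= L -> 0 <= K ->
  (forall x y, x \in D -> lsqn (alt a sg p [:: (x, y)]) <= L * sqn y) ->
  (size D)%:R * L <= K ^+ p ->
  {subset [seq q.1 | q <- l] <= D} ->
  lsqn (step a sg false l) <= M2 * lsqn l ->
  lsqn (step a sg false l) <= K * lsqn l.
Proof.
move=> p0 L0 K0 DL DK lD stepM.
(* When l has norm 0 no root can be taken, and the crude bound with M2 settles the case. *)
have := lsqn_ge0 l; rewrite le0r => /orP[/eqP lE|lp].
  by rewrite lE mulr0; move: stepM; rewrite lE mulr0.
have uD := undup_uniq D; set s := undup D in uD.
have ls : {subset [seq q.1 | q <- l] <= s} by move=> x /lD; rewrite mem_undup.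
have altE : lsqn (alt a sg p l) =
    lsqn (flatten [seq alt a sg p [:: (x, rep l x)] | x <- s]).
  apply: lsqn_ext => z.
  have -> : rep (flatten [seq alt a sg p [:: (x, rep l x)] | x <- s]) z =
      \sum_(x <- s) rep (alt a sg p [:: (x, rep l x)]) z.
    rewrite /rep; elim: (s) => [|x s' IH]; first by rewrite !big_nil.
    by rewrite /= big_cat big_cons IH.
  under eq_bigr => x _ do rewrite rep_wop.
  rewrite rep_wop exchange_big; apply: eq_bigr => w _ /=.
  transitivity (\sum_(x <- s | wact sg w x == z) \sum_(q <- l | q.1 == x) wact a w q.2);
    last first.
    rewrite [LHS]big_mkcond; apply: eq_bigr => x _; rewrite [RHS]big_mkcond big_seq1.
    by case: ifP => // _; rewrite linop_sum //; exact: wact_linear.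
  rewrite (exchange_big_dep (fun q => wact sg w q.1 == z)) /=; last first.
    by move=> x q xz /eqP ->.
  rewrite [LHS]big_seq_cond [RHS]big_seq_cond; apply: eq_bigr => q /andP[ql qz].
  rewrite (eq_bigl (pred1 q.1)); last first.
    by move=> x; rewrite /= andbC eq_sym; case: eqP => // ->; rewrite qz.
  by rewrite -big_filter filter_pred1_uniq ?big_seq1 // ls // map_f.
have altK : lsqn (alt a sg p l) <= K ^+ p * lsqn l.
  rewrite altE; apply: (le_trans (lsqn_flatten_le _ _)).
  apply: (le_trans (y := (size s)%:R * (L * lsqn l))); last first.
    rewrite mulrA ler_wpM2r ?(ltW lp) //; apply: le_trans DK.
    by rewrite ler_wpM2r // ler_nat size_undup.
  rewrite ler_wpM2l // (lsqn_cover uD ls) mulr_sumr [leLHS]big_seq [leRHS]big_seq.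
  by apply: ler_sum => x; rewrite mem_undup => xD; apply: DL.
have h : lsqn (step a sg false l) ^+ p * lsqn l <= lsqn (alt a sg p l) * lsqn l ^+ p.
  exact: lsqn_step_pow.
have {}h := le_trans h (ler_wpM2r (exprn_ge0 p (ltW lp)) altK).
have {}h : lsqn (step a sg false l) ^+ p <= (K * lsqn l) ^+ p.
  by rewrite -(ler_pM2r lp) exprMn mulrAC.
by move: h; rewrite ler_pXn2r // nnegrE ?lsqn_ge0 // mulr_ge0 // ltW.
Qed.

Lemma lsqn_single x l (L : R) : 0 <= L -> (forall y, rn (a x y) <= L * rn y) ->
  lsqn (wop a sg [:: [:: x]] l) <= L ^+ 2 * lsqn l.
Proof.
move=> L0 aL; set s := undup [seq p.1 | p <- l].
have us : uniq s by exact: undup_uniq.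
have inj : injective (sg x) := can_inj (sgK x).
rewrite (@lsqn_cover _ _ _ (map (sg x) s)); last first.
- move=> z; rewrite /wop /= cats0 -map_comp => /mapP[q ql ->] /=.
  by rewrite map_f // mem_undup map_f.
- by rewrite map_inj_uniq.
rewrite (lsqn_undup l) -/s big_map mulr_sumr; apply: ler_sum => z _.
have -> : rep (wop a sg [:: [:: x]] l) (sg x z) = a x (rep l z).
  rewrite rep_wop big_seq1 /= /rep linop_sum //; apply: eq_bigl => q.
  by rewrite (inj_eq inj).
by rewrite !sqnE -exprMn ler_pXn2r // nnegrE ?mulr_ge0 ?rn_ge0.
Qed.

Lemma lsqn_step_bounded : (forall x, exists2 L : R, 0 <= L & forall y, rn (a x y) <= L * rn y) ->
  exists2 C : R, 0 <= C & forall l, lsqn (step a sg false l) <= C ^+ 2 * lsqn l.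
Proof.
move=> aL; have /choice[L hL] x : exists L : R, 0 <= L /\ forall y, rn (a x y) <= L * rn y.
  by have [L L0 h] := aL x; exists L.
pose B := (size (letters I false))%:R * \sum_(x <- letters I false) L x ^+ 2.
have B0 : 0 <= B by rewrite mulr_ge0 //; apply: sumr_ge0 => x _; rewrite sqr_ge0.
exists (Num.sqrt B) => [|l]; first exact: sqrtr_ge0.
rewrite sqr_sqrtr // /step.
have -> : wop a sg [seq [:: x] | x <- letters I false] l =
    flatten [seq wop a sg [:: [:: x]] l | x <- letters I false].
  rewrite /wop; elim: (letters I false) => //= x s IH.
  by rewrite cats0 IH.
apply: (le_trans (lsqn_flatten_le _ _)); rewrite /B -mulrA ler_wpM2l // mulr_suml.
by apply: ler_sum => x _; apply: lsqn_single; case: (hL x).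
Qed.

Lemma sqn_rep_le l z : sqn (rep l z) <= lsqn l.
Proof.
rewrite lsqn_undup; set s := undup _.
have [zs|zs] := boolP (z \in s).
  rewrite (bigD1_seq z) ?undup_uniq //= lerDl; apply: sumr_ge0 => *; exact: sqn_ge0.
rewrite /rep big_seq_cond big_pred0 ?/sqn ?rip0l; last first.
  move=> q; apply/negP => /andP[ql /eqP qz]; move/negP: zs; apply.
  by rewrite mem_undup -qz map_f.
by apply: sumr_ge0 => *; exact: sqn_ge0.
Qed.

End LocalPower.

Section OperatorNorm.
Variables (R : realType) (H : hilbertType R) (X : choiceType).
Variable T : (X -> H) -> (X -> H).

Lemma opnorm_ge0 : (0 <= opnorm T)%E.
Proof.
apply: (@le_trans _ _ (sqrte (l2sqnorm (T (fun _ => 0))))); first exact: sqrte_ge0.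
apply: ereal_sup_ubound; exists (fun _ => 0) => //=; rewrite /l2sqnorm esum1 ?lee01 // => z _.
by rewrite normr0 expr0n.
Qed.

(** The map T is not assumed linear, so its values on all multiples of l are part of the hypothesis;
    they serve to normalize l. *)
Lemma opnorm_lsqn (M : R) (l l' : seq (X * H)) : 0 <= M -> (opnorm T <= M%:E)%E ->
  (forall c, T (rep (lscale c l)) = rep (lscale c l')) -> lsqn l' <= M ^+ 2 * lsqn l.
Proof.
move=> M0 TM Tl.
have h (c : R) : c ^+ 2 * lsqn l <= 1 -> c ^+ 2 * lsqn l' <= M ^+ 2.
  move=> cl; have : (sqrte (l2sqnorm (T (rep (lscale c l)))) <= M%:E)%E.
    apply: le_trans TM; apply: ereal_sup_ubound; exists (rep (lscale c l)) => //=.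
    by rewrite l2sqnorm_rep lsqn_scale lee_fin.
  rewrite Tl l2sqnorm_rep lsqn_scale /= lee_fin => s.
  have l0 : 0 <= c ^+ 2 * lsqn l' by rewrite mulr_ge0 ?sqr_ge0 ?lsqn_ge0.
  by rewrite -(sqr_sqrtr l0) ler_pXn2r // nnegrE sqrtr_ge0.
have := lsqn_ge0 l; rewrite le0r => /orP[/eqP lE|lp].
  rewrite lE mulr0 leNgt; apply/negP => l'p.
  (* If l has norm 0, every scaling is admissible, and this one would give M^2 + 1 <= M^2. *)
  have := h (Num.sqrt ((M ^+ 2 + 1) / lsqn l')); rewrite lE mulr0 sqr_sqrtr.
    by rewrite divfK ?gt_eqF // => /(_ ler01); lra.
  by rewrite divr_ge0 ?(ltW l'p) // addr_ge0 // sqr_ge0.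
have := h (Num.sqrt (lsqn l)^-1); rewrite sqr_sqrtr ?invr_ge0 ?(ltW lp) //.
rewrite mulVf ?gt_eqF // => /(_ (lexx _)).
by rewrite mulrC ler_pdivrMr.
Qed.

End OperatorNorm.

Section FreeGroupAction.
Variables (R : realType) (H : hilbertType R) (d : nat).
Local Notation I := 'I_(d + d).+1.
Local Notation F := (free_group d).

(** Index 0 receives the unit, so that a_0 is treated as one more letter; this gives 2d + 1
    letters. *)
Definition group_letter (i : I) : F :=
  if unlift ord0 i is Some j then fg_letter j else 1%g.

Definition free_act (x : I * bool) (h : F) : F :=
  ((if x.2 then (group_letter x.1)^-1 else group_letter x.1) * h)%g.

Lemma free_actK x : cancel (free_act x) (free_act (lstar x)).
Proof. by case: x => i [] h; rewrite /free_act /= ?mulKg ?mulVKg. Qed.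

Lemma wact_free_act w h : wact free_act w h = (wact free_act w 1 * h)%g.
Proof.
by elim: w => [|x w IH] /=; rewrite ?mul1g // IH /free_act mulgA.
Qed.

Lemma wact_free_act_eq w h : (wact free_act w h == h) = (wact free_act w 1%g == 1%g).
Proof.
rewrite wact_free_act; apply/eqP/eqP => [e|->]; last by rewrite mul1g.
by rewrite -(mulgK h (wact _ _ _)) e mulgV.
Qed.

Lemma group_letterP (i : I) : group_letter i = 1%g \/
  exists x : 'I_d * bool, word (group_letter i) = [:: x].
Proof.
rewrite /group_letter; case: unliftP => [j _|_]; last by left.
right; rewrite /fg_letter /fam_double; case: fintype.split => k.
  by exists (k, false).
by exists (k, true).
Qed.

Lemma group_letter_inj : injective group_letter.
Proof.
move=> i j; rewrite /group_letter.
case: (unliftP ord0 i) => [i'|] ->; case: (unliftP ord0 j) => [j'|] -> //.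
- rewrite /fg_letter /fam_double => e; congr (lift _ _).
  case: (splitP i') e => u iE; case: (splitP j') => v jE.
  + by move/(congr1 (@word d)) => -[uv]; apply/ord_inj; rewrite iE jE uv.
  + by move/(congr1 (@word d)).
  + by move/(congr1 (@word d)).
  + by move/(congr1 (@word d)) => -[uv]; apply/ord_inj; rewrite iE jE uv.
- rewrite /fg_letter /fam_double; case: fintype.split => u.
    by move/(congr1 (@word d)).
  by move/(congr1 (@word d)).
- rewrite /fg_letter /fam_double; case: fintype.split => u.
    by move/(congr1 (@word d)).
  by move/(congr1 (@word d)).
Qed.

Definition free_ht (h : F) : nat := size (word h).
(** Left multiplication acts at the head of a word, so the tails are the vertices on the way to the
    root. Past the root the value stays at the empty word. *)
Definition free_anc (j : nat) (h : F) : seq ('I_d * bool) := drop j (word h).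

Lemma free_act_cases (i : I) (h : F) : let h' := free_act (i, false) h in
  [\/ h' = h, exists x, word h' = x :: word h | exists x, word h = x :: word h'].
Proof.
rewrite /free_act /=; case: (group_letterP i) => [->|[x xE]].
  by rewrite mul1g; constructor 1.
have -> : Defs.wmul (group_letter i) h = lcons x (word h) by rewrite xE.
case: (word h) => [|y w] /=; first by constructor 2; exists x.
by case: eqP => _; [constructor 3; exists y | constructor 2; exists x].
Qed.

Lemma free_ht_step (i : I) (h : F) : let h' := free_act (i, false) h in
  [\/ h' = h, free_ht h' = (free_ht h).+1 | free_ht h = (free_ht h').+1].
Proof.
rewrite /free_ht; case: (free_act_cases i h) => [|[x ->]|[x ->]] /=.
- by constructor 1.
- by constructor 2.
- by constructor 3.
Qed.

Lemma free_anc_up (i : I) (h : F) : let h' := free_act (i, false) h in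
  free_ht h' = (free_ht h).+1 -> forall j, free_anc j.+1 h' = free_anc j h.
Proof.
rewrite /free_ht /free_anc; case: (free_act_cases i h) => [->|[x ->]|[x ->]] //=; lia.
Qed.

Lemma free_anc_down (i : I) (h : F) : let h' := free_act (i, false) h in
  free_ht h = (free_ht h').+1 -> forall j, free_anc j.+1 h = free_anc j h'.
Proof.
rewrite /free_ht /free_anc; case: (free_act_cases i h) => [->|[x ->]|[x ->]] //=; lia.
Qed.

Fixpoint short_words (n : nat) : seq (seq ('I_d * bool)) :=
  if n is k.+1 then [::] :: [seq x :: u | x <- enum {: 'I_d * bool}, u <- short_words k]
  else [:: [::]].

Lemma mem_short_words n u : (size u <= n)%N -> u \in short_words n.
Proof.
elim: n u => [|n IH] [|x u] //= un; rewrite inE; apply/orP; right.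
by apply: allpairs_f; [rewrite mem_enum | exact: IH].
Qed.

Lemma size_short_words n : (size (short_words n) <= (d + d).+1 ^ n)%N.
Proof.
elim: n => // n IH; rewrite /= size_allpairs -cardE card_prod card_ord card_bool.
have : (0 < (d + d).+1 ^ n)%N by rewrite expn_gt0.
rewrite expnS; nia.
Qed.

(** Unreduced concatenations become the unit. This is harmless: the list only has to contain the
    ball and be short. *)
Definition free_ball (n : nat) (v : seq ('I_d * bool)) : seq F :=
  [seq insubd (fg_one d) (u ++ v) | u <- short_words n].

Lemma mem_free_ball n v h j : (j <= n)%N -> free_anc j h = v -> h \in free_ball n v.
Proof.
move=> jn <-; apply/mapP; exists (take j (word h)); last by rewrite cat_take_drop valKd.
by apply: mem_short_words; rewrite size_take; case: ltnP => // /leq_trans; apply.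
Qed.

Variable a : I -> H -> H.
Hypothesis la : forall i, linear (a i).

Definition star_family (x : I * bool) : H -> H := if x.2 then adj (a x.1) else a x.1.

Lemma A_free_rep l : A_free a (rep l) = rep (step star_family free_act false l).
Proof.
apply/funext => h; rewrite /rep big_step /A_free.
rewrite !fctE !fct_sumE enumT -/(index_enum _) big_ord_recl /ampl; congr (_ + _).
  rewrite linop_sum //; apply: eq_bigl => q.
  by rewrite /free_act /group_letter unlift_none mul1g.
apply: eq_bigr => i _; rewrite /tens_lreg /ampl /lreg /= linop_sum //; apply: eq_bigl => q.
rewrite /free_act /group_letter liftK /=.
by apply/eqP/eqP => [->|<-]; rewrite ?mulVKg ?mulKg.
Qed.

End FreeGroupAction.

Section PermutationAction.
Variables (R : realType) (H : hilbertType R) (d N : nat).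
Local Notation I := 'I_(d + d).+1.
Variables (a : I -> H -> H) (U : 'I_d -> 'M[R[i]]_N) (s : 'I_d -> 'S_N).
Hypothesis la : forall i, linear (a i).
Hypothesis Us : forall j, U j = perm_mx (s j).

Definition perm_letter (i : I) : 'S_N :=
  if unlift ord0 i is Some j then fam_double s (fun k => (s k)^-1)%g j else 1%g.

(* [perm_mx s] maps a function [f] to [f \o s], so that the letter [i] moves
   [delta_k] to the basis vector at the inverse image of [k]. *)
Definition perm_act (x : I * bool) (k : 'I_N) : 'I_N :=
  (if x.2 then perm_letter x.1 else (perm_letter x.1)^-1)%g k.

Lemma perm_actK x : cancel (perm_act x) (perm_act (lstar x)).
Proof. by case: x => i [] k; rewrite /perm_act /= ?permK ?permKV. Qed.

Lemma tens_mx_perm (b : H -> H) (t : 'S_N) f k : tens_mx b (perm_mx t) f k = b (f (t k)).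
Proof.
rewrite /tens_mx (bigD1 (t k)) //= mxE mxE eqxx scale1r big1 ?addr0 // => j jk.
by rewrite !mxE eq_sym (negbTE jk) scale0r.
Qed.

Lemma perm_mx_adjoint (t : 'S_N) :
  ((perm_mx t : 'M[R[i]]_N) ^t*)%sesqui = perm_mx (t^-1)%g.
Proof.
apply/matrixP => i j; rewrite !mxE rmorph_nat; congr (_%:R); congr nat_of_bool.
by apply/eqP/eqP => [<-|<-]; rewrite ?permK ?permKV.
Qed.

Lemma A_mx_rep l : A_mx a U (rep l) = rep (step (star_family a) perm_act false l).
Proof.
apply/funext => k; rewrite /rep big_step /A_mx.
rewrite !fctE !fct_sumE enumT -/(index_enum _) big_ord_recl /ampl; congr (_ + _).
  rewrite linop_sum //; apply: eq_bigl => q.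
  by rewrite /perm_act /perm_letter unlift_none /= invg1 perm1.
apply: eq_bigr => i _.
have -> : fam_double U (fun j => (U j ^t*)%sesqui) i = perm_mx (perm_letter (lift ord0 i)).
  rewrite /perm_letter liftK /fam_double; case: fintype.split => j; rewrite Us //.
  exact: perm_mx_adjoint.
rewrite tens_mx_perm linop_sum //; apply: eq_bigl => q.
rewrite /perm_act /=; apply/eqP/eqP => [->|<-]; by rewrite ?permK ?permKV.
Qed.

Lemma PiN_sum0 (f : 'I_N -> H) : \sum_k f k = 0 -> PiN H N f = f.
Proof.
move=> f0; apply/funext => k; rewrite /PiN /tens_mx.
have -> : \sum_j (1%:M - proj_ones R N) k j *: f j =
    \sum_j ((k == j)%:R *: f j - proj_ones R N k j *: f j).
  by apply: eq_bigr => j _; rewrite !mxE scalerBl.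
rewrite big_split /= sumrN (bigD1 k) //= eqxx scale1r big1 ?addr0; last first.
  by move=> j jk; rewrite eq_sym (negbTE jk) scale0r.
have pE j : proj_ones R N k j = proj_ones R N k k.
  by rewrite /proj_ones !mxE !big_ord1 !mxE.
by under eq_bigr => j _ do rewrite pE; rewrite -scaler_sumr f0 scaler0 subr0.
Qed.

Lemma A_mx_PiN_rep l : \sum_(q <- l) q.2 = 0 ->
  (A_mx a U \o PiN H N) (rep l) = rep (step (star_family a) perm_act false l).
Proof.
move=> l0; rewrite /= PiN_sum0 ?A_mx_rep // /rep.
rewrite (exchange_big_dep xpredT) //= -[RHS]l0; apply: eq_bigr => q _.
by rewrite (eq_bigl (pred1 q.1)) ?big_pred1_eq // => k; rewrite /= eq_sym.
Qed.

(* The letter [(j, false)] of a word stands for the generator acting as the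
   inverse of [s j]. *)
Definition letter_act (x : 'I_d * bool) (k : 'I_N) : 'I_N :=
  (if x.2 then s x.1 else (s x.1)^-1)%g k.

Definition word_act (u : seq ('I_d * bool)) (k : 'I_N) : 'I_N := foldr letter_act k u.

Lemma word_act_lcons x u k : word_act (lcons x u) k = letter_act x (word_act u k).
Proof.
case: u => [|y u] //=; case: eqP => // ->; case: x => j [].
  by rewrite /letter_act /= permKV.
by rewrite /letter_act /= permK.
Qed.

Lemma word_act_mul u v k : word_act (Defs.wmul u v) k = word_act u (word_act v k).
Proof. by elim: u => //= x u IH; rewrite word_act_lcons IH. Qed.

Lemma word_act_letter i k : word_act (group_letter i) k = perm_act (i, false) k.
Proof.
rewrite /group_letter /perm_act /perm_letter /=; case: unliftP => [j _|_] /=; last first.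
  by rewrite invg1 perm1.
rewrite /fg_letter /fam_double; case: fintype.split => u //=.
by rewrite invgK.
Qed.

Lemma word_act_free_act x h k :
  word_act (free_act x h) k = perm_act x (word_act h k).
Proof.
have mulE (g g' : free_group d) :
  word_act (g * g')%g k = word_act g (word_act g' k) by exact: word_act_mul.
case: x => i []; last by rewrite mulE word_act_letter.
have hE : h = (group_letter i * free_act (i, true) h)%g by rewrite /free_act /= mulVKg.
by rewrite [in RHS]hE mulE word_act_letter /perm_act /= permKV.
Qed.

Lemma word_act_one k : word_act (1 : free_group d)%g k = k.
Proof. by [].
Qed.

(** Acting on k through [word_act] intertwines left translation with the permutations; evaluate at
    the unit. *)
Lemma wact_perm_fixed w k : wact (@free_act d) w 1%g = 1%g -> wact perm_act w k = k.
Proof.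
move=> w1; have h (g : free_group d) :
    word_act (wact (@free_act d) w g) k = wact perm_act w (word_act g k).
  by elim: w {w1} => //= x w IH; rewrite word_act_free_act IH.
by have := h 1%g; rewrite w1 word_act_one.
Qed.

End PermutationAction.

(** * Comparison of coefficients *)

Section CenteredVectors.
Variables (R : realType) (H : hilbertType R) (I : finType) (N : nat).
Variables (a : I * bool -> H -> H) (sg : I * bool -> 'I_N -> 'I_N).
Hypothesis la : forall x, linear (a x).
Hypothesis sgK : forall x, cancel (sg x) (sg (lstar x)).
Hypothesis N0 : (0 < N)%N.
Variable k0 : 'I_N.

Let Ninv : R := N%:R^-1.
Let NinvE : N%:R * Ninv = 1.
Proof. by rewrite divff // pnatr_eq0 -lt0n. Qed.

(* The projection of y (x) delta_k0 to the orthogonal of the constants. *)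
Definition centered (y : H) : seq ('I_N * H) :=
  (k0, y) :: [seq (k, - (Ninv%:C *: y)) | k <- enum 'I_N].

Lemma sum_const_enum (V : nmodType) (c : V) : \sum_(k <- enum 'I_N) c = c *+ N.
Proof. by rewrite big_enum /= sumr_const card_ord. Qed.

Lemma sum_centered y : \sum_(q <- centered y) q.2 = 0.
Proof.
rewrite big_cons big_map /= sum_const_enum.
rewrite -scaler_nat scalerN scalerA -(rmorph_nat (real_complex R)) -rmorphM /=.
by rewrite NinvE scale1r subrr.
Qed.

Lemma rep_centered y k : rep (centered y) k = ((k0 == k)%:R - Ninv)%:C *: y.
Proof.
rewrite /rep big_cons big_map /= big_enum_cond /= big_pred1_eq.
case: eqP => _ /=; first by vec_ring.
by rewrite sub0r rmorphN scaleNr.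
Qed.

Lemma wact_inj w : injective (wact sg w).
Proof. by elim: w => //= x w IH; apply: inj_comp => //; exact: can_inj (sgK x). Qed.

(** Every word permutes the points and fixes the constants, so centering just subtracts 1/N from
    each diagonal entry. *)
Lemma lip_wop_centered S y z : lip (wop a sg S (centered y)) (centered z) =
  \sum_(w <- S) ((wact sg w k0 == k0)%:R - Ninv) * rip (wact a w y) z.
Proof.
rewrite lipE big_wop; apply: eq_bigr => w _; rewrite big_cons big_map /=.
rewrite rep_centered ripZr eq_sym.
have -> : \sum_(k <- enum 'I_N) rip (wact a w (- (Ninv%:C *: y)))
    (rep (centered z) (wact sg w k)) = 0; last by rewrite addr0.
under eq_bigr => k _ do rewrite rep_centered ripZr.
rewrite -mulr_suml -[RHS](mul0r (rip (wact a w (- (Ninv%:C *: y))) z)); congr (_ * _).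
rewrite big_split /= sum_const_enum big_enum /=.
rewrite -mulr_natl mulrN NinvE.
have -> : \sum_(i in 'I_N) (k0 == wact sg w i)%:R = \sum_(k in 'I_N) (k0 == k)%:R :> R.
  by rewrite [RHS](reindex_inj (@wact_inj w)).
rewrite (bigD1 k0) //= eqxx big1 ?addr0 ?subrr // => k; rewrite eq_sym.
by move=> /negbTE ->.
Qed.

Lemma lsqn_centered y : lsqn (centered y) <= sqn y.
Proof.
have := lip_wop_centered [:: [::]] y y; rewrite wop1 big_seq1 /= eqxx /lsqn => ->.
have : 0 <= Ninv * sqn y by rewrite mulr_ge0 ?invr_ge0 ?sqn_ge0.
by rewrite mulrBl [true%:R * _]mul1r -/(sqn y); lra.
Qed.

Lemma sum_wop S (l : seq ('I_N * H)) : \sum_(q <- l) q.2 = 0 ->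
  \sum_(q <- wop a sg S l) q.2 = 0.
Proof.
move=> l0; rewrite big_wop big1 // => w _ /=.
by rewrite -linop_sum ?l0 ?linop0 //; exact: wact_linear.
Qed.

End CenteredVectors.

Section CoefficientBound.
Variables (R : realType) (H : hilbertType R) (A : set (H -> H)).
Variable tau : (H -> H) -> R[i].
Hypothesis hA : unital_cstar_algebra A.
Hypothesis htau : state_on A tau.
Hypothesis ftau : faithful_on A tau.
Variables (d N : nat) (a : 'I_(d + d).+1 -> H -> H) (s : 'I_d -> {perm 'I_N}).
Hypothesis Aa : forall i, A (a i).
Hypothesis moments : nonneg_joint_moments tau a.
Local Notation letter := ('I_(d + d).+1 * bool)%type.
Local Notation b := (star_family a).
Local Notation rt := (rtau tau).

Lemma star_family_mem x : A (b x).
Proof.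
by case: x => i []; rewrite /star_family //=; case: (cstar_adjoint hA (Aa i)).
Qed.

Lemma star_family_linear x : linear (b x).
Proof. exact: (cstar_linear hA (star_family_mem x)). Qed.

Lemma star_family_adjoint x : is_adjoint (b x) (b (lstar x)).
Proof.
have [Aai aai] : A (adj (a x.1)) /\ is_adjoint (a x.1) (adj (a x.1)).
  exact: cstar_adjoint.
case: x Aai aai => i [] /= Aai aai; rewrite /star_family /= //.
apply: rip_adjoint; first exact: (cstar_linear hA Aai).
exact: adjoint_rip'.
Qed.

Local Notation lb := star_family_linear.
Local Notation adj_b := star_family_adjoint.

Lemma wact_mem w : A (wact b w).
Proof.
elim: w => [|x w IH]; first exact: (cstar_unit hA).
exact: (cstar_mul hA (star_family_mem x)).
Qed.

Lemma rtau_word_ge0 w : 0 <= rt (wact b w).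
Proof.
have : 0 <= tau (\big[(fun f g => f \o g)/id]_(k < size w) b (tnth (in_tuple w) k)).
  exact: (moments (fun k : 'I_(size w) => (tnth (in_tuple w) k).1)
    (fun k => (tnth (in_tuple w) k).2)).
rewrite -(big_tnth id (fun f g => f \o g) w xpredT b).
suff -> : \big[(fun f g => f \o g)/id]_(x <- w) b x = wact b w.
  by rewrite lecE => /andP[_].
by elim: w => [|x w IH]; rewrite ?big_nil // big_cons IH.
Qed.

(** The cone on which the moment hypothesis gives positivity. Closure under composition places the
    powers of T in it. *)
Definition word_sum (c : H -> H) : Prop :=
  exists S : seq (seq letter), forall y, c y = \sum_(w <- S) wact b w y.

Lemma word_sum_rtau_ge0 c : word_sum c -> 0 <= rt c.
Proof.
move=> [S cE]; have -> : c = fun y => \sum_(w <- S) wact b w y by apply/funext.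
rewrite (rtau_sum hA htau); last exact: wact_mem.
by apply: sumr_ge0 => w _; exact: rtau_word_ge0.
Qed.

Lemma word_sum_comp c c' : word_sum c -> word_sum c' -> word_sum (c \o c').
Proof.
move=> [S cE] [S' cE']; exists [seq u ++ w | u <- S, w <- S'] => y.
rewrite big_allpairs_dep /= cE; apply: eq_bigr => u _; rewrite cE' linop_sum.
  by apply: eq_bigr => w _; rewrite wact_cat.
by apply: wact_linear; exact: lb.
Qed.

Lemma word_sum_filter (S : seq (seq letter)) (P : pred (seq letter)) :
  word_sum (fun y => \sum_(w <- S | P w) wact b w y).
Proof. by exists [seq w <- S | P w] => y; rewrite big_filter. Qed.

Lemma word_sum_iter c n : word_sum c -> word_sum (iter n c).
Proof.
move=> ws; elim: n => [|n IH]; last exact: word_sum_comp.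
by exists [:: [::]] => y; rewrite big_seq1.
Qed.

Lemma mem_word_sum c : word_sum c -> A c.
Proof.
move=> [S cE]; have -> : c = fun y => \sum_(w <- S) wact b w y by apply/funext.
by apply: cstar_sum => // w; exact: wact_mem.
Qed.

Variables (p : nat) (n2 x2 : R) (k0 : 'I_N).
Hypotheses (n20 : 0 <= n2) (x20 : 0 <= x2).
Hypothesis norm_N : forall l : seq ('I_N * H), \sum_(q <- l) q.2 = 0 ->
  lsqn (step b (perm_act s) false l) <= n2 * lsqn l.
Hypothesis norm_sum : forall y, sqn (\sum_i a i y) <= x2 * sqn y.

Let N0 : (0 < N)%N. Proof. by case: (N) k0 => // -[]. Qed.

Let T := diag_coef b (@free_act d) p 1%g.
Let W := diag_coef b (perm_act s) p k0.
Let X0 y := \sum_(w <- square_words 'I_(d + d).+1 p) wact b w y.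

Let TE y z : rip (T y) z = lip (alt b (@free_act d) p [:: (1%g, y)])
  (alt b (@free_act d) p [:: (1%g, z)]).
Proof. by rewrite lip_alt_delta //; [exact: adj_b | exact: free_actK]. Qed.

(** X0 is the diagonal coefficient for the trivial action on one point, where A becomes the sum of
    the a_i. *)
Let X0E y z : rip (X0 y) z = lip (alt b (fun _ => @id unit) p [:: (tt, y)])
  (alt b (fun _ => @id unit) p [:: (tt, z)]).
Proof.
by rewrite lip_alt_delta //; exact: adj_b.
Qed.

Let X0_le y : rip (X0 y) y <= x2 ^+ p * sqn y.
Proof.
rewrite X0E; have unitE (l : seq (unit * H)) : lsqn l = sqn (\sum_(q <- l) q.2).
  by rewrite (@lsqn_cover _ _ _ [:: tt]) ?big_seq1.
rewrite -/(lsqn _).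
have -> : sqn y = lsqn [:: (tt, y)] by rewrite unitE big_seq1.
apply: (@lsqn_alt_le _ _ _ _ adj_b _ _ (fun _ => frefl _) (fun _ => True)) => // r _.
rewrite !unitE /step big_wop big_map /letters big_map.
rewrite (_ : \sum_(i <- _) _ = \sum_i a i (\sum_(q <- r) q.2)); first exact: norm_sum.
rewrite big_enum /=; apply: eq_bigr => i _; rewrite linop_sum //.
exact: (cstar_linear hA (Aa i)).
Qed.

Let E y := W y - (N%:R^-1)%:C *: X0 y.

Let EE y z : rip (E y) z = lip (alt b (perm_act s) p (centered k0 y))
  (alt b (perm_act s) p (centered k0 z)).
Proof.
rewrite lip_alt_alt; [|exact: adj_b|exact: perm_actK].
rewrite (lip_wop_centered _ (@perm_actK d N s) N0).
rewrite /E ripDl ripNl ripZl /W /X0 /diag_coef !rip_suml mulr_sumr big_mkcond -sumrB.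
by apply: eq_bigr => w _; case: eqP => _; rewrite /=; ring.
Qed.

Let E_le y : rip (E y) y <= n2 ^+ p * sqn y.
Proof.
rewrite EE; apply: (le_trans (y := n2 ^+ p * lsqn (centered k0 y))); last first.
  by rewrite ler_wpM2l ?exprn_ge0 // (@lsqn_centered _ _ _ _ b _ (@perm_actK d N s) N0).
rewrite -/(lsqn _).
apply: (@lsqn_alt_le _ _ _ _ adj_b _ _ (@perm_actK d N s)
  (fun l => \sum_(q <- l) q.2 = 0)) => //; last exact: sum_centered.
by move=> S r; apply: sum_wop; exact: lb.
Qed.

Let wsT : word_sum T := word_sum_filter _ _.
Let wsW : word_sum W := word_sum_filter _ _.
Let wsX0 : word_sum X0 := word_sum_filter _ xpredT.

Let sT : rself_adjoint T.
Proof. by move=> y z; rewrite TE lip_sym -TE rip_sym. Qed.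

(** For c = T^k, passing from T to W uses nonnegativity of moments of words. The remaining bounds,
    on E = W - X0 / N and on X0, are operator inequalities to which [rtau_positive] applies. The
    product c T c is an odd power of T, which is why [faithful_moments] asks only for ratios at even
    exponents. *)
Lemma diag_coef_bound y : rip (T y) y <= (n2 ^+ p + x2 ^+ p / N%:R) * sqn y.
Proof.
have AT := mem_word_sum wsT; have AW := mem_word_sum wsW; have AX := mem_word_sum wsX0.
have pT : form_positive T by move=> z; rewrite TE lsqn_ge0.
apply: (faithful_moments hA htau AT sT pT _ _ ftau).
  by rewrite addr_ge0 ?mulr_ge0 ?exprn_ge0 ?invr_ge0.
move=> k; set c := iter k T.
have wsc : word_sum c := word_sum_iter k wsT.
have Ac := mem_word_sum wsc; have lc := cstar_linear hA Ac.
have sc : rself_adjoint c.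
  by rewrite /c; elim: (k) => // j IH u v; rewrite iterS sT IH -iterSr.
pose q (V : H -> H) := rt (fun y => c (V (c y))).
have AcV V : A V -> A (fun y => c (V (c y))).
  by move=> AV; do 2 apply: (cstar_mul hA) => //.
have qB V V' : A V -> A V' -> q (fun y => V y - V' y) = q V - q V'.
  move=> AV AV'; rewrite /q -(rtauB hA htau); [|exact: AcV..].
  by congr rtau; apply/funext => z; rewrite (linopB _ _ lc).
have qZ r V : A V -> q (fun y => r%:C *: V y) = r * q V.
  move=> AV; rewrite /q -(rtauZ hA htau); last exact: AcV.
  by congr rtau; apply/funext => z; rewrite (linopZ _ _ lc).
have q_ge0 V : A V -> rself_adjoint V -> form_positive V -> 0 <= q V.
  move=> AV sV pV; apply: (rtau_positive hA htau AV sV pV Ac).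
  exact: rself_adjoint_adjoint.
have AI := cstar_unit hA.
have AZ r V : A V -> A (fun y => r%:C *: V y) by exact: (cstar_scale hA).
have TW : q T <= q W.
  rewrite -subr_ge0 -qB //.
  (* What remains of W - T: the words that fix k0 without being trivial in the free group. *)
  pose V y := \sum_(w <- square_words 'I_(d + d).+1 p |
     (wact (perm_act s) w k0 == k0) && (wact (@free_act d) w 1%g != 1%g)) wact b w y.
  have -> : q (fun y => W y - T y) = q V.
    congr rtau; apply/funext => z; congr c; set t := c z.
    rewrite /W /T /V /diag_coef.
    rewrite (bigID (fun w => wact (@free_act d) w 1%g == 1%g)) /= addrAC.
    rewrite [X in X - _](eq_bigl (fun w => wact (@free_act d) w 1%g == 1%g)).
      by rewrite subrr add0r.
    move=> w /=; case: (wact (@free_act d) w 1%g =P 1%g) => [e|]; last by rewrite andbF.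
    by rewrite (wact_perm_fixed s k0 e) eqxx.
  apply: word_sum_rtau_ge0; apply: (word_sum_comp wsc).
  by apply: (word_sum_comp (word_sum_filter _ _) wsc).
have EW : q W - N%:R^-1 * q X0 <= n2 ^+ p * q id.
  rewrite -qZ // -qB //; last exact: AZ.
  rewrite -subr_ge0 -qZ // -qB; [|exact: AZ|by apply: (cstar_sub hA) => //; exact: AZ].
  apply: q_ge0.
  - by apply: (cstar_sub hA); [exact: AZ | apply: (cstar_sub hA) => //; exact: AZ].
  - move=> u v; rewrite ripDl ripDr ripNl ripNr ripZl ripZr -/(E u) -/(E v).
    by rewrite EE lip_sym -EE [rip (E v) u]rip_sym.
  - by move=> u; rewrite ripDl ripNl ripZl -/(E u) subr_ge0 E_le.
have XI : q X0 <= x2 ^+ p * q id.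
  rewrite -subr_ge0 -qZ // -qB //; last exact: AZ.
  apply: q_ge0.
  - by apply: (cstar_sub hA) => //; exact: AZ.
  - move=> u v; rewrite ripDl ripDr ripNl ripNr ripZl ripZr.
    by rewrite X0E lip_sym -X0E [rip (X0 v) u]rip_sym.
  - by move=> u; rewrite ripDl ripNl ripZl subr_ge0 X0_le.
have -> : iter k.*2.+1 T = fun y => c (T (c y)).
  by apply/funext => z; rewrite /c -iterS -iterD addnS addnn.
have -> : rtau tau (iter k.*2 T) = q id.
  by congr rtau; apply/funext => z; rewrite /c -iterD addnn.
rewrite -/(q T); apply: (le_trans TW).
have : N%:R^-1 * q X0 <= N%:R^-1 * (x2 ^+ p * q id) by rewrite ler_wpM2l ?invr_ge0.
lra.
Qed.

End CoefficientBound.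

(** * The norm inequality *)

Section NormInequality.
Variables (R : realType) (H : hilbertType R) (A : set (H -> H)).
Variable tau : (H -> H) -> R[i].
Hypothesis hA : unital_cstar_algebra A.
Hypothesis htau : state_on A tau.
Hypothesis ftau : faithful_on A tau.
Variables (d N : nat) (a : 'I_(d + d).+1 -> H -> H).
Hypothesis Aa : forall i, A (a i).
Hypothesis moments : nonneg_joint_moments tau a.
Local Notation b := (star_family a).
Local Notation stepF := (step b (@free_act d) false).
Local Notation B := ((d + d).+1%:R : R).

Let lb x : linear (b x). Proof. exact: (star_family_linear hA Aa). Qed.
Let adj_b x : is_adjoint (b x) (b (lstar x)). Proof. exact: (star_family_adjoint hA Aa). Qed.
Let la i : linear (a i). Proof. exact: (cstar_linear hA (Aa i)). Qed.

Lemma A_free_ext f g h :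
  (forall i, f (free_act (i, true) h) = g (free_act (i, true) h)) ->
  A_free a f h = A_free a g h.
Proof.
move=> fg; rewrite /A_free !fctE !fct_sumE /ampl; congr (_ + _).
  have := fg ord0; rewrite /free_act /group_letter unlift_none /=.
  by rewrite invg1 mul1g => ->.
apply: eq_bigr => i _; rewrite /tens_lreg /ampl /lreg /=.
by have := fg (lift ord0 i); rewrite /free_act /group_letter liftK /= => ->.
Qed.

(** Finitely supported vectors suffice: a finite partial sum of |A_F f|^2 sees only finitely many
    values of f, by [A_free_ext]. *)
Lemma opnorm_A_free_le (c : R) : 0 <= c ->
  (forall l, lsqn (stepF l) <= c * lsqn l) -> (opnorm (A_free a) <= (Num.sqrt c)%:E)%E.
Proof.
move=> c0 hc; apply: ge_ereal_sup => _ [f /= f1 <-].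
suff h : (l2sqnorm (A_free a f) <= c%:E)%E.
  have -> : (Num.sqrt c)%:E = sqrte c%:E by [].
  by rewrite lee_sqrt ?lee_fin.
apply: ub_ereal_sup => _ [S [fS _] <-].
have [S' SE] := (finite_seqP S).1 fS.
pose s := undup [seq free_act (i, true) h | h <- S', i <- enum 'I_(d + d).+1].
pose l := [seq (x, f x) | x <- s].
have repl x : rep l x = if x \in s then f x else 0.
  rewrite /rep /l big_map /=; case: ifP => xs.
    by rewrite -big_filter filter_pred1_uniq ?big_seq1 // undup_uniq.
  rewrite big_seq_cond big_pred0 // => z; apply/negP => /andP[zs /eqP zx].
  by rewrite -zx zs in xs.
rewrite (eq_fsbigr (fun x => (complex.Re `|rep (stepF l) x| ^+ 2)%:E)); last first.
  move=> h hS; rewrite -A_free_rep // (@A_free_ext f (rep l) h) // => i.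
  rewrite repl ifT // mem_undup; apply: allpairs_f; last by rewrite mem_enum.
  by move: hS; rewrite SE inE.
apply: (le_trans (y := l2sqnorm (rep (stepF l)))).
  by apply: ereal_sup_ubound; exists S.
rewrite l2sqnorm_rep lee_fin; apply: (le_trans (hc l)).
rewrite -[leRHS]mulr1 ler_wpM2l // -lee_fin -l2sqnorm_rep.
apply: le_trans f1; apply: le_esum => x _; rewrite lee_fin repl.
by case: ifP => // _; rewrite normr0 expr0n /= sqr_ge0.
Qed.

Lemma rep_step_lscale (X : choiceType) (sg : 'I_(d + d).+1 * bool -> X -> X) c l :
  rep (step b sg false (lscale c l)) = rep (lscale c (step b sg false l)).
Proof.
apply/funext => z; rewrite -![lscale c _]/(vscale (fun=> c) _) rep_vscale !rep_step.
rewrite scaler_sumr; apply: eq_bigr => i _; rewrite big_map scaler_sumr.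
by apply: eq_bigr => q _ /=; rewrite (linopZ _ _ (lb (i, false))).
Qed.

Lemma opnorm_A_free_fin : exists2 M : R, 0 <= M & opnorm (A_free a) = M%:E.
Proof.
have [C C0 hC] : exists2 C : R, 0 <= C & forall l, lsqn (stepF l) <= C ^+ 2 * lsqn l.
  apply: lsqn_step_bounded; [exact: lb|exact: free_actK|].
  by move=> x; apply: (cstar_bound hA); exact: (star_family_mem hA Aa).
have le := opnorm_A_free_le (sqr_ge0 C) hC.
have ge := @opnorm_ge0 R H _ (A_free a).
move: le ge; case: (opnorm _) => [M|//|//] _ ge.
by exists M => //; rewrite -lee_fin.
Qed.

Variables (M : R) (s : 'I_d -> {perm 'I_N}) (n : R) (k0 : 'I_N).
Hypotheses (M0 : 0 <= M) (normF : opnorm (A_free a) = M%:E) (n0 : 0 <= n).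
Hypothesis norm_N : forall l : seq ('I_N * H), \sum_(q <- l) q.2 = 0 ->
  lsqn (step b (perm_act s) false l) <= n ^+ 2 * lsqn l.

Lemma stepF_le l : lsqn (stepF l) <= M ^+ 2 * lsqn l.
Proof.
apply: (@opnorm_lsqn _ _ _ (A_free a)) => //; first by rewrite normF.
by move=> c; rewrite A_free_rep // rep_step_lscale.
Qed.

(** The letters are distinct group elements, so a_i y is the component at the i-th letter of A_F
    applied to y (x) delta_1. *)
Lemma coef_le i y : rn (a i y) <= M * rn y.
Proof.
rewrite -(@ler_pXn2r _ 2) ?nnegrE ?mulr_ge0 ?rn_ge0 // exprMn -!sqnE.
apply: (le_trans (y := lsqn (stepF [:: (1%g, y)]))); last first.
  apply: (le_trans (stepF_le _)).
  by rewrite /lsqn /lip big_seq1 big_mkcond big_seq1 eqxx.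
suff <- : rep (stepF [:: (1%g, y)]) (group_letter i) = a i y by exact: sqn_rep_le.
rewrite rep_step (bigD1_seq i) ?mem_enum ?enum_uniq //=.
rewrite big_mkcond big_seq1 /free_act /= mulg1 eqxx big1 ?addr0 // => j ji.
rewrite big_mkcond big_seq1 /= mulg1; case: eqP => // /group_letter_inj e.
by rewrite e eqxx in ji.
Qed.

Lemma sum_coef_le y : sqn (\sum_i a i y) <= (B * M) ^+ 2 * sqn y.
Proof.
have h : rn (\sum_i a i y) <= B * M * rn y.
  apply: (le_trans (rn_sum _ _ _)).
  apply: (le_trans (y := \sum_(i < (d + d).+1) (M * rn y))).
    by apply: ler_sum => i _; exact: coef_le.
  by rewrite sumr_const card_ord -[X in X <= _]mulr_natl mulrA.
by rewrite !sqnE -exprMn ler_pXn2r // nnegrE ?mulr_ge0 ?rn_ge0.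
Qed.

Lemma norm_inequality (p m : nat) (K e : R) : (0 < p)%N -> (0 < m)%N -> 0 <= K -> 0 < e ->
  B ^+ m.*2 * (n ^+ p.*2 + (B * M) ^+ p.*2 / N%:R) <= K ^+ p ->
  M ^+ 2 * tent_mass R m <=
  (1 + e) * (K * tent_mass R m) + (1 + e^-1) * (M ^+ 2 * (4 * m.*2%:R)).
Proof.
move=> p0 m0 K0 e0 hK; set L := _ + _ in hK.
have L0 : 0 <= L by rewrite addr_ge0 ?divr_ge0 ?exprn_ge0 ?mulr_ge0.
have TL (h : free_group d) y : lsqn (alt b (@free_act d) p [:: (h, y)]) <= L * sqn y.
  rewrite /lsqn lip_alt_delta //; last exact: free_actK.
  (* Left translations commute with right ones, so the diagonal is constant. *)
  have -> : diag_coef b (@free_act d) p h y = diag_coef b (@free_act d) p 1%g y.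
    by apply: eq_bigl => w; exact: wact_free_act_eq.
  have := diag_coef_bound hA htau ftau Aa moments p k0 (sqr_ge0 n) (sqr_ge0 (B * M))
    norm_N sum_coef_le y.
  by rewrite -!exprM !mul2n.
have local v l : (forall q, q \in [seq x.1 | x <- l] ->
    exists2 j, (j <= m.*2)%N & free_anc j q = v) -> lsqn (stepF l) <= K * lsqn l.
  move=> lv; apply: (@lsqn_step_local _ _ _ _ _ _ lb adj_b (@free_actK d) p
    (free_ball m.*2 v) L K (M ^+ 2)) => //.
  - apply: le_trans hK; rewrite ler_wpM2r // size_map -natrX ler_nat.
    exact: size_short_words.
  - by move=> q /lv[j jm qv]; exact: mem_free_ball jm qv.
  - exact: stepF_le.
have W0 : 0 < tent_mass R m.
  apply: lt_le_trans (tent_mass_ge R m0).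
  by rewrite divr_gt0 // mulr_gt0 // exprn_gt0 // ltr0n.
set c := _ + _ * (_ * (4 * _)).
have c0 : 0 <= c.
  by rewrite addr_ge0 ?mulr_ge0 ?addr_ge0 ?invr_ge0 ?(ltW e0) ?(ltW W0) ?sqr_ge0.
(* The localized estimate holds for all finitely supported vectors, so it bounds M itself, although
   M also occurs in its error term. *)
have := @opnorm_A_free_le (c / tent_mass R m) (divr_ge0 c0 (ltW W0)).
rewrite normF lee_fin => h; rewrite -ler_pdivlMr //.
rewrite -(sqr_sqrtr (divr_ge0 c0 (ltW W0))) ler_pXn2r // ?nnegrE ?sqrtr_ge0 //.
apply: h => l; rewrite mulrAC ler_pdivlMr // mulrC.
apply: (localization lb (sqr_ge0 M) stepF_le (@free_ht_step d) (@free_anc_up d)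
  (@free_anc_down d) local l e0).
Qed.

End NormInequality.

(** * Numerical estimates and the choice of parameters *)

Section Numerics.
Variable R : realType.

Lemma ln2_bounds : 1 / 2 <= ln 2 :> R.
Proof.
rewrite -ler_expR lnK ?posrE //.
have := expR_ge1Dx (- (1 / 2) : R); rewrite expRN => h.
have e0 := expR_gt0 (1 / 2 : R).
have : expR (1 / 2) * (expR (1 / 2))^-1 = 1 :> R by rewrite divff // gt_eqF.
nra.
Qed.

Lemma expR_half (y : R) : 2 * expR (y - 1) <= expR y.
Proof.
have -> : expR y = expR (y - 1) * expR 1 by rewrite -expRD subrK.
have := expR_ge1Dx (1 : R) => h1.
by rewrite mulrC ler_wpM2l ?expR_ge0 //; lra.
Qed.

Lemma one_sub_ge_expR (x : R) : 0 <= x -> x <= 1 / 2 -> expR (- (2 * x)) <= 1 - x.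
Proof.
move=> x0 x1; rewrite expRN -[X in X <= _]mul1r ler_pdivrMr ?expR_gt0 //.
have := expR_ge1Dx (2 * x) => h.
have : (1 - x) * (1 + 2 * x) <= (1 - x) * expR (2 * x) by rewrite ler_wpM2l //; lra.
nra.
Qed.

(* With S = sqrt (ln N) and t = ln (2d), the radius m is about S / t and the
   exponent p about S^2 / (16 t). *)
Lemma numeric_contradiction (B q S t : R) (m p : nat) :
  1 / 2 <= t -> 200 * t < S -> 1 <= B -> ln B <= 2 * t ->
  S / (2 * t) <= m%:R -> m%:R <= S / t ->
  S ^+ 2 / (32 * t) <= p%:R -> p%:R <= S ^+ 2 / (16 * t) ->
  0 <= q -> q <= 1 - 200 * (t / S) ->
  (1 - 20 / m%:R) ^+ p < B ^+ m.*2 * (q ^+ p.*2 + B ^+ p.*2 / expR (S ^+ 2)) -> False.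
Proof.
move=> t0 tS B1 lnB mS Sm pS Sp q0 q1.
have tp : 0 < t by lra.
have Sp0 : 0 < S by lra.
have S100 : 100 < S by lra.
have mp : 100 <= m%:R :> R.
  by apply: le_trans mS; rewrite ler_pdivlMr; lra.
have pp : 0 <= p%:R :> R by [].
have lnB0 : 0 <= ln B by exact: ln_ge0.
have BE k : B ^+ k = expR (k%:R * ln B).
  by rewrite expRM_natl lnK // posrE; lra.
(* The left side is at least exp y, and y >= -5 S by [pm]. *)
pose y : R := - (40 * (p%:R / m%:R)).
have pm : p%:R / m%:R <= S / 8.
  rewrite ler_pdivrMr; last lra.
  apply: (le_trans Sp); apply: (le_trans (y := S / 8 * (S / (2 * t)))).
    by rewrite le_eqVlt; apply/orP; left; apply/eqP; field; lra.
  by rewrite ler_wpM2l //; lra.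
have lhs : expR y <= (1 - 20 / m%:R) ^+ p.
  have -> : y = p%:R * (- (2 * (20 / m%:R))).
    by rewrite /y; field; lra.
  have m20 : 20 / m%:R <= 1 / 2 :> R by rewrite ler_pdivrMr; lra.
  have m200 : 0 <= 20 / m%:R :> R by rewrite divr_ge0.
  rewrite expRM_natl; apply: lerXn2r; rewrite ?nnegrE ?expR_ge0 //; first lra.
  exact: one_sub_ge_expR.
have mlnB : m.*2%:R * ln B <= 4 * S.
  rewrite -muln2 natrM; apply: (le_trans (y := S / t * 2 * (2 * t))).
    by rewrite ler_pM // ?mulr_ge0 // ler_pM2r.
  by rewrite le_eqVlt; apply/orP; left; apply/eqP; field; lra.
have plnB : p.*2%:R * ln B <= S ^+ 2 / 4.
  rewrite -muln2 natrM; apply: (le_trans (y := S ^+ 2 / (16 * t) * 2 * (2 * t))).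
    by rewrite ler_pM // ?mulr_ge0 // ler_pM2r.
  by rewrite le_eqVlt; apply/orP; left; apply/eqP; field; lra.
(* Here 200 enters: 25/2 = 200/16 has to exceed 4 (the ball, [mlnB]) plus 5 (the left side). *)
have qE : q ^+ p.*2 <= expR (- (25 / 2 * S)).
  apply: (le_trans (y := expR (p.*2%:R * (- (200 * (t / S)))))).
    rewrite expRM_natl; apply: lerXn2r; rewrite ?nnegrE ?expR_ge0 //.
    by apply: (le_trans q1); exact: expR_ge1Dx.
  rewrite ler_expR mulrN lerN2 -muln2 natrM.
  apply: (le_trans (y := S ^+ 2 / (32 * t) * 2 * (200 * (t / S)))).
    by rewrite le_eqVlt; apply/orP; left; apply/eqP; field; lra.
  apply: ler_wpM2r; first by rewrite mulr_ge0 // divr_ge0 ?(ltW tp) ?(ltW Sp0).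
  by rewrite ler_pM2r.
apply/negP; rewrite -leNgt; apply: le_trans lhs.
rewrite mulrDr !BE -expRN -!expRD.
apply: (le_trans (y := expR (4 * S) * expR (- (25 / 2 * S)) + expR (4 * S + (S ^+ 2 / 4 - S ^+ 2)))).
  apply: lerD.
    by rewrite ler_pM ?expR_ge0 ?exprn_ge0 // ler_expR.
  by rewrite ler_expR; lra.
have h1 : expR (4 * S + - (25 / 2 * S)) <= expR (y - 1) by rewrite ler_expR /y; lra.
(* The 1/N term: S^2 is ln N and B^(2p) is at most N^(1/4), so the exponent is negative quadratic in
   S > 100. *)
have h2 : expR (4 * S + (S ^+ 2 / 4 - S ^+ 2)) <= expR (y - 1).
  by rewrite ler_expR /y; nra.
have := expR_half y; rewrite -(expRD (4 * S)); lra.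
Qed.

End Numerics.

Lemma half_le_nat_le (R : realType) (x : R) : 1 <= x -> exists k : nat, x / 2 <= k%:R <= x.
Proof.
move=> x1; exists (Num.truncn x).
have /andP[h1 h2] : (Num.truncn x)%:R <= x < (Num.truncn x).+1%:R.
  by apply: truncn_itv; lra.
rewrite h1 andbT; case: (Num.truncn x) h1 h2 => [|k] h1 h2; first by lra.
have e1 : k.+1%:R = k%:R + 1 :> R by rewrite natr1.
have e2 : k.+2%:R = k%:R + 1 + 1 :> R by rewrite !natr1.
by have : 0 <= k%:R :> R by []; lra.
Qed.

Lemma double_succ_le_sqr (d : nat) : (0 < d)%N -> ((d + d).+1 <= (2 * d) ^ 2)%N.
Proof. by move=> d0; rewrite expnS expn1; nia. Qed.

Theorem theorem1p7 (R : realType) :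
  exists c : R, 0 < c /\
  forall (d N : nat) (H1 : hilbertType R) (A1 : set (H1 -> H1))
    (tau1 : (H1 -> H1) -> R[i]) (a : 'I_(d + d).+1 -> H1 -> H1)
    (U : 'I_d -> 'M[R[i]]_N),
  (1 <= d)%N -> (2 <= N)%N ->
  unital_cstar_algebra A1 ->
  state_on A1 tau1 -> faithful_on A1 tau1 -> normal_on A1 tau1 ->
  (forall i, A1 (a i)) ->
  nonneg_joint_moments tau1 a ->
  (forall i, is_perm_mx (U i)) ->
  (opnorm (A_free a) * (1 - c * (ln (2 * d)%:R / Num.sqrt (ln N%:R)))%:E
     <= opnorm (A_mx a U \o PiN H1 N))%E.
Proof.
exists 200; split=> // d N H1 A1 tau1 a U d1 N2 hA htau ftau _ Aa moments Uperm.
have [M M0 normF] := opnorm_A_free_fin hA Aa.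
have normN0 := opnorm_ge0 (A_mx a U \o PiN H1 N).
move normNE: (opnorm (A_mx a U \o PiN H1 N)) normN0 => [n||//] n0; last by rewrite leey.
rewrite lee_fin in n0; rewrite normF -EFinM lee_fin leNgt; apply/negP => ltn.
set t := ln (2 * d)%:R in ltn; set S := Num.sqrt (ln N%:R) in ltn.
have /choice[s Us] j : exists s, U j = perm_mx s.
  by have /is_perm_mxP[s sE] := Uperm j; exists s.
pose k0 : 'I_N := Ordinal (ltnW N2).
have la i := cstar_linear hA (Aa i).
have norm_N (l : seq ('I_N * H1)) : \sum_(q <- l) q.2 = 0 ->
    lsqn (step (star_family a) (perm_act s) false l) <= n ^+ 2 * lsqn l.
  move=> l0; apply: (@opnorm_lsqn _ _ _ (A_mx a U \o PiN H1 N)) => //.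
    by rewrite normNE.
  move=> c; rewrite (A_mx_PiN_rep la Us).
    by rewrite (rep_step_lscale hA Aa).
  by rewrite big_map /= -scaler_sumr l0 scaler0.
have Mp : 0 < M.
  rewrite lt0r M0 andbT; apply/eqP => ME; move: ltn; rewrite ME mul0r; lra.
(* Since n >= 0, a counterexample requires a positive lower bound. Hence S > 200 t, and the
   parameters below are large. *)
have pos : 0 < 1 - 200 * (t / S).
  by rewrite -(pmulr_rgt0 _ Mp); apply: le_lt_trans ltn.
have t2 : 1 / 2 <= t.
  apply: (le_trans (ln2_bounds R)); rewrite ler_ln ?posrE ?ltr0n ?ler_nat; lia.
have lnN : 0 < ln N%:R :> R by rewrite ln_gt0 // ltr1n.
have Sp : 0 < S by rewrite sqrtr_gt0.
have S2 : S ^+ 2 = ln N%:R by rewrite sqr_sqrtr // ltW.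
have tS : 200 * t < S.
  by have : 200 * t / S < 1 by [lra | rewrite -mulrA; lra]; rewrite ltr_pdivrMr // mul1r.
have tp : 0 < t by lra.
have St : 200 <= S / t by rewrite ler_pdivlMr // ltW.
have /half_le_nat_le[m /andP[m1 m2]] : 1 <= S / t by lra.
have /half_le_nat_le[p /andP[p1 p2]] : 1 <= S ^+ 2 / (16 * t).
  by rewrite ler_pdivlMr; nra.
have m100 : 100 <= m%:R :> R by lra.
have m0 : (0 < m)%N by rewrite -(ltr_nat R); lra.
have p0 : (0 < p)%N.
  rewrite -(ltr_nat R); apply: lt_le_trans p1; rewrite !divr_gt0 ?mulr_gt0 ?exprn_gt0 //.
set u : R := m%:R in m100.
pose B : R := (d + d).+1%:R.
pose K := M ^+ 2 * (1 - 20 / u).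
have u20 : 20 / u <= 1 by rewrite ler_pdivrMr; lra.
have K0 : 0 <= K by rewrite mulr_ge0 ?sqr_ge0 // subr_ge0.
(* If K bounds A_F on balls, localization with e = 3/u is contradictory: (1 + 3/u)(1 - 20/u) = 1 -
   17/u - 60/u^2, and the loss 17/u on a mass of at least 2u^3/3 outweighs the error 8u + 8u^2/3.
   Otherwise [numeric_contradiction] applies to the normalized norm q = n / M. *)
have [hK|] := leP (B ^+ m.*2 * (n ^+ p.*2 + (B * M) ^+ p.*2 / N%:R)) (K ^+ p).
  have e0 : 0 < 3 / u by rewrite divr_gt0 //; lra.
  have := norm_inequality hA htau ftau Aa moments k0 M0 normF n0 norm_N p0 m0 K0 e0 hK.
  have := tent_mass_ge R m0; set W := tent_mass R m; rewrite -/u => hW.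
  have M2 : 0 < M ^+ 2 by rewrite exprn_gt0.
  have -> : (1 + 3 / u) * (K * W) + (1 + (3 / u)^-1) * (M ^+ 2 * (4 * m.*2%:R)) =
      M ^+ 2 * ((1 - 17 / u - 60 / u ^+ 2) * W + (8 * u + 8 / 3 * u ^+ 2)).
    by rewrite /K -muln2 natrM -/u; field; lra.
  rewrite ler_pM2l // => h.
  have u2 : 0 < u ^+ 2 by rewrite exprn_gt0 //; lra.
  have u3 : 0 < u ^+ 3 by rewrite exprn_gt0 //; lra.
  have h1 : W * (17 * u + 60) <= u ^+ 2 * (8 * u + 8 / 3 * u ^+ 2).
    have -> : W * (17 * u + 60) = u ^+ 2 * (W - (1 - 17 / u - 60 / u ^+ 2) * W).
      by field; lra.
    by rewrite ler_pM2l //; lra.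
  have h2 : 2 * u ^+ 3 / 3 * (17 * u + 60) <= W * (17 * u + 60).
    by rewrite ler_wpM2r //; lra.
  have h3 : 0 < u ^+ 3 * (26 / 3 * u + 32) by rewrite mulr_gt0 //; lra.
  have h4 : u ^+ 2 * (8 * u + 8 / 3 * u ^+ 2) = u ^+ 3 * (8 + 8 / 3 * u) by ring.
  by lra.
move=> hK; apply: (@numeric_contradiction R B (n / M) S t m p) => //.
- by rewrite /B -natr1 lerDr.
- have d2 : (0 < 2 * d)%N by rewrite muln_gt0.
  have dB := double_succ_le_sqr d1.
  have -> : 2 * t = ln (((2 * d) ^ 2)%N%:R).
    by rewrite natrX lnXn ?ltr0n // mulr_natl.
  by rewrite ler_ln ?posrE ?ltr0n ?expn_gt0 ?d2 ?ler_nat.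
- by apply: le_trans m1; rewrite le_eqVlt; apply/orP; left; apply/eqP; field; lra.
- by apply: le_trans p1; rewrite le_eqVlt; apply/orP; left; apply/eqP; field; lra.
- by rewrite divr_ge0.
- by rewrite ler_pdivrMr // mulrC ltW.
rewrite S2 lnK ?posrE ?ltr0n ?(ltnW N2) //.
have M2p : 0 < M ^+ p.*2 by rewrite exprn_gt0.
rewrite -(ltr_pM2l M2p).
have -> : M ^+ p.*2 * (1 - 20 / m%:R) ^+ p = K ^+ p.
  by rewrite /K exprMn -exprM mul2n.
apply: (lt_le_trans hK); rewrite le_eqVlt; apply/orP; left; apply/eqP.
rewrite exprMn expr_div_n; field.
by rewrite pnatr_eq0 -lt0n (ltnW N2) gt_eqF.
Qed.
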